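(* Let $P$ be a path linkage with $k\ge2$ edges, all of positive length, and let $p,q\in M(P)$. Let $\alpha:[0,1]\to[P]$ be continuous such that, for some $\epsilon>0$ and $\delta>0$, $\alpha(x)=\theta(p)$ for all $x\in[0,\epsilon]$ and $\alpha(x)=\theta(q)$ for all $x\in[1-\delta,1]$. If $\alpha([0,1])\cap\nabla(P)\ne\emptyset$, then there exists a continuous $\tilde\alpha:[0,1]\to M(P)$ with $\tilde\alpha(0)=p$, $\tilde\alpha(1)=q$ and $\theta\circ\tilde\alpha=\alpha$.
   Context: A path linkage is a linkage $P=(G,l)$ where $G$ is a path graph with vertices $1,\dots,k+1$ and edges $\{i,i+1\}$; its terminal vertices are $s=1$, $t=k+1$. $C(P)=\{p:V\to\mathbb R^2:|p(u)-p(v)|=l(\{u,v\})\text{ for every edge}\}$, and $M(P)$ is the quotient of $C(P)$ by the group of orientation preserving isometries of $\mathbb R^2$, with the quotient topology. $\theta:M(P)\to\mathbb R$, $\theta(p)=|p(s)-p(t)|$, and $[P]=\theta(M(P))$. $\nabla(P)=\{x\in[P]:\theta^{-1}(x)\text{ is connected}\}$. *)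

(* Defs.v *)
From Stdlib Require Import Reals.
Open Scope R_scope.

(* A path linkage with k edges: vertices are indexed 0..k (paper: 1..k+1),
   edges {i,i+1} for i < k, with lengths l i.  s = vertex 0, t = vertex k.
   A placement p : V -> R^2 is represented by a function nat -> R*R, of which
   only the values at 0..k matter. *)
Definition config := nat -> (R * R).

Definition edist (u v : R * R) : R :=
  sqrt ((fst u - fst v)^2 + (snd u - snd v)^2).

Definition inC (k : nat) (l : nat -> R) (p : config) : Prop :=
  forall i : nat, (i < k)%nat -> edist (p i) (p (S i)) = l i.

(* q is the image of p under an orientation preserving isometry of R^2
   (a rotation followed by a translation), on the vertices 0..k. *)
Definition congruent (k : nat) (p q : config) : Prop :=
  exists c s a b : R, c ^ 2 + s ^ 2 = 1 /\
    forall i : nat, (i <= k)%nat ->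
      fst (q i) = c * fst (p i) - s * snd (p i) + a /\
      snd (q i) = s * fst (p i) + c * snd (p i) + b.

(* distance between placements in (R^2)^(k+1) (any product metric gives the
   product topology) *)
Definition cdist (k : nat) (p q : config) : R :=
  sum_f_R0 (fun i => edist (p i) (q i)) k.

(* Open subsets of M(P) for the quotient topology correspond exactly to
   saturated subsets of C(P) that are open in C(P) (subspace topology of
   (R^2)^(k+1)).  We represent an open set of M(P) by such a saturated set. *)
Definition Mopen (k : nat) (l : nat -> R) (U : config -> Prop) : Prop :=
  (forall p q, inC k l p -> inC k l q -> congruent k p q -> U p -> U q) /\
  (forall p, inC k l p -> U p ->
     exists eps, eps > 0 /\
       forall q, inC k l q -> cdist k p q < eps -> U q).

Definition theta (k : nat) (p : config) : R := edist (p O) (p k).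

Definition range_P (k : nat) (l : nat -> R) (x : R) : Prop :=
  exists p, inC k l p /\ theta k p = x.

(* theta^{-1}(x), as a saturated subset of C(P) *)
Definition fiber (k : nat) (l : nat -> R) (x : R) (p : config) : Prop :=
  inC k l p /\ theta k p = x.

(* connectedness of a subset F of M(P) (F given as a saturated subset of C(P))
   for the subspace topology of the quotient topology *)
Definition Mconnected (k : nat) (l : nat -> R) (F : config -> Prop) : Prop :=
  ~ (exists U1 U2 : config -> Prop,
        Mopen k l U1 /\ Mopen k l U2 /\
        (forall p, F p -> U1 p \/ U2 p) /\
        (forall p, F p -> U1 p -> U2 p -> False) /\
        (exists p, F p /\ U1 p) /\
        (exists p, F p /\ U2 p)).

Definition nabla (k : nat) (l : nat -> R) (x : R) : Prop :=
  range_P k l x /\ Mconnected k l (fiber k l x).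

Definition cont01 (f : R -> R) : Prop :=
  forall t, 0 <= t <= 1 -> forall e, e > 0 ->
    exists d, d > 0 /\ forall s, 0 <= s <= 1 -> Rabs (s - t) < d ->
      Rabs (f s - f t) < e.

(* a map [0,1] -> M(P), given by choosing representatives f t in C(P), is
   continuous for the quotient topology on M(P): preimages of open sets of
   M(P) are open in [0,1]. *)
Definition Mpath_cont (k : nat) (l : nat -> R) (f : R -> config) : Prop :=
  forall U, Mopen k l U ->
    forall t, 0 <= t <= 1 -> U (f t) ->
      exists d, d > 0 /\ forall s, 0 <= s <= 1 -> Rabs (s - t) < d -> U (f s).

(* Main.v *)
Require Import Defs.
From Stdlib Require Import Reals Lra Lia List Permutation Classical.
From Coquelicot Require Import Coquelicot.
Open Scope R_scope.

(* A placement is studied through its edge vectors [v i], complex numbers of modulus [l i], so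
   that [theta] is the modulus of their sum and edges may be reordered.  Let [a] and [b] be the
   two longest edges.

   In every fiber of [theta] the half [0 <= cross (v a) (v b)] is path connected.  By induction
   on the other edges: since each is at most [l b], one edge can be turned monotonically to a
   position depending on the fiber only, the rest of the linkage following a continuous section
   of [theta].

   If the fiber over [x0] is connected, it contains a placement with [v a] parallel to [v b],
   since otherwise the sign of [cross (v a) (v b)] would disconnect it.  Through such a
   placement, up to moving it inside the fiber, pass two sections of [theta] defined on its
   whole range, one in each half.

   The lift is then obtained by moving [p] inside its half fiber to one of the two sections
   while [alpha] is constant, following that section along [alpha], changing section at the
   time where [alpha] takes the value [x0], and moving to [q] at the end. *)

(** The two longest edges are singled out because every other edge satisfies [l i <= l b]. With [S]
    the total length of the edges of [rest], the linkage formed by these and by [a], [b] has range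
    from [lo = max 0 (l a - l b - S)] to [hi = l a + l b + S]. If a further edge of length [l]
    cannot point against the total vector [X], because [Cmod X + l > hi], then
    [Cmod X - l > l a - l b + S >= lo] follows from [l <= l b], and it can point along [X]. So one
    of the two extreme positions is always available. The recurring obstacle is a vector that
    shrinks to zero: its direction may have no limit, and a triangle built on it need not vary
    continuously. This is the origin of most case distinctions. Connectedness of one fiber enters
    only through an aligned pair of edges in it. All maps are total on the real line and use [Rmin],
    [Rmax] and [clamp], so that their continuity needs no gluing argument; the metric properties of
    sections are claimed only on the relevant interval. *)

(** * Continuity of real functions *)

Lemma continuity_add (f g : R -> R) :
  continuity f -> continuity g -> continuity (fun t => f t + g t).
Proof. exact (continuity_plus f g). Qed.

Lemma continuity_sub (f g : R -> R) :
  continuity f -> continuity g -> continuity (fun t => f t - g t).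
Proof. exact (continuity_minus f g). Qed.

Lemma continuity_neg (f : R -> R) : continuity f -> continuity (fun t => - f t).
Proof. exact (continuity_opp f). Qed.

Lemma continuity_mul (f g : R -> R) :
  continuity f -> continuity g -> continuity (fun t => f t * g t).
Proof. exact (continuity_mult f g). Qed.

Lemma continuity_cst (c : R) : continuity (fun _ => c).
Proof. apply continuity_const; intros x y; reflexivity. Qed.

Lemma continuity_ident : continuity (fun t => t).
Proof. exact (derivable_continuous _ derivable_id). Qed.

Lemma continuity_divide (f g : R -> R) :
  continuity f -> continuity g -> (forall t, g t <> 0) ->
  continuity (fun t => f t / g t).
Proof. intros; now apply (continuity_div f g). Qed.

Lemma continuity_compose (f g : R -> R) :
  continuity f -> continuity g -> continuity (fun t => f (g t)).
Proof. intros Hf Hg; exact (continuity_comp g f Hg Hf). Qed.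

Lemma continuity_square (f : R -> R) : continuity f -> continuity (fun t => f t ^ 2).
Proof.
  intros Hf; apply (continuity_mul f (fun t => f t * 1)); auto.
  apply (continuity_mul f (fun _ => 1)); auto using continuity_cst.
Qed.

Lemma continuity_absolute (f : R -> R) : continuity f -> continuity (fun t => Rabs (f t)).
Proof. intros Hf; exact (continuity_compose Rabs f Rcontinuity_abs Hf). Qed.

Lemma continuity_root (f : R -> R) : continuity f -> continuity (fun t => sqrt (f t)).
Proof.
  intros Hf; apply (continuity_compose sqrt f); auto.
  intros x; apply continuity_pt_filterlim, continuous_sqrt.
Qed.

Lemma continuity_ext (f g : R -> R) : (forall t, f t = g t) -> continuity f -> continuity g.
Proof. intros E Hf t; exact (continuity_pt_ext f g t E (Hf t)). Qed.

Lemma continuity_max (f g : R -> R) :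
  continuity f -> continuity g -> continuity (fun t => Rmax (f t) (g t)).
Proof.
  intros Hf Hg.
  apply continuity_ext with (fun t => (f t + g t + Rabs (f t - g t)) * / 2).
  - intros t; unfold Rmax, Rabs.
    destruct (Rle_dec (f t) (g t)), (Rcase_abs (f t - g t)); lra.
  - auto using continuity_mul, continuity_cst, continuity_add, continuity_absolute,
      continuity_sub.
Qed.

Lemma continuity_min (f g : R -> R) :
  continuity f -> continuity g -> continuity (fun t => Rmin (f t) (g t)).
Proof.
  intros Hf Hg.
  apply continuity_ext with (fun t => - Rmax (- f t) (- g t)).
  - intros t; unfold Rmax, Rmin.
    destruct (Rle_dec (f t) (g t)), (Rle_dec (- f t) (- g t)); lra.
  - auto using continuity_neg, continuity_max.
Qed.

Ltac splits := repeat match goal with |- _ /\ _ => split end.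

Create HintDb cont.
#[local] Hint Resolve continuity_add continuity_sub continuity_neg continuity_mul
  continuity_cst continuity_ident continuity_square continuity_absolute continuity_root
  continuity_max continuity_min : cont.

(** * Continuous plane curves *)

Definition ccont (f : R -> C) : Prop :=
  continuity (fun t => fst (f t)) /\ continuity (fun t => snd (f t)).

Lemma ccont_ext (f g : R -> C) : (forall t, f t = g t) -> ccont f -> ccont g.
Proof.
  intros E [H1 H2]; split; [revert H1|revert H2]; apply continuity_ext;
    intros t; now rewrite E.
Qed.

Lemma ccont_pair (f g : R -> R) :
  continuity f -> continuity g -> ccont (fun t => (f t, g t)).
Proof. now split. Qed.

Lemma ccont_const (c : C) : ccont (fun _ => c).
Proof. split; apply continuity_cst. Qed.

Lemma ccont_plus (f g : R -> C) : ccont f -> ccont g -> ccont (fun t => f t + g t)%C.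
Proof. intros [] []; split; simpl; auto with cont. Qed.

Lemma ccont_minus (f g : R -> C) : ccont f -> ccont g -> ccont (fun t => f t - g t)%C.
Proof. intros [] []; split; simpl; auto with cont. Qed.

Lemma ccont_mult (f g : R -> C) : ccont f -> ccont g -> ccont (fun t => f t * g t)%C.
Proof. intros [] []; split; simpl; auto with cont. Qed.

Lemma ccont_conj (f : R -> C) : ccont f -> ccont (fun t => Cconj (f t)).
Proof. intros []; split; simpl; auto with cont. Qed.

Lemma ccont_comp (f : R -> C) (g : R -> R) :
  ccont f -> continuity g -> ccont (fun t => f (g t)).
Proof.
  intros [H1 H2] Hg; split.
  - exact (continuity_compose (fun t => fst (f t)) g H1 Hg).
  - exact (continuity_compose (fun t => snd (f t)) g H2 Hg).
Qed.

#[local] Hint Resolve ccont_pair ccont_const ccont_plus ccont_minus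
  ccont_mult ccont_conj : cont.

(** * Moduli, rotations and triangles *)

Lemma Cmod_sqr (z : C) : Cmod z ^ 2 = fst z ^ 2 + snd z ^ 2.
Proof. exact (Cmod2_alt z). Qed.

Lemma Cmod_unique (z : C) (r : R) : 0 <= r -> fst z ^ 2 + snd z ^ 2 = r ^ 2 -> Cmod z = r.
Proof. intros Hr E; unfold Cmod; rewrite E; now apply sqrt_pow2. Qed.

Lemma Rsqr_le_inv (x y : R) : 0 <= y -> x ^ 2 <= y ^ 2 -> x <= y.
Proof. nra. Qed.

Definition cross (u v : C) : R := fst u * snd v - snd u * fst v.

Lemma cross_rot (e u v : C) : Cmod e = 1 -> cross (e * u)%C (e * v)%C = cross u v.
Proof.
  intros He; pose proof (Cmod_sqr e) as E; rewrite He in E.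
  unfold cross; destruct e as [c s], u as [u1 u2], v as [v1 v2]; simpl in *.
  transitivity ((c * (c * 1) + s * (s * 1)) * (u1 * v2 - u2 * v1)); [ring|].
  rewrite <- E; ring.
Qed.

Lemma cross_conj (u v : C) : cross (Cconj u) (Cconj v) = - cross u v.
Proof. unfold cross; simpl; ring. Qed.

Lemma rotation_path (e : C) : Cmod e = 1 ->
  exists g : R -> C, ccont g /\ (forall t, Cmod (g t) = 1) /\ g 0 = 1%C /\ g 1 = e.
Proof.
  intros He; pose proof (Cmod_sqr e) as E; rewrite He in E.
  destruct e as [c s]; simpl in E.
  assert (Hang : exists th, cos th = c /\ sin th = s).
  { assert (Hc : -1 <= c <= 1) by nra.
    assert (Hs : sqrt (1 - Rsqr c) = Rabs s).
    { replace (1 - Rsqr c) with (Rsqr s) by (unfold Rsqr; lra). apply sqrt_Rsqr_abs. }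
    destruct (Rle_lt_dec 0 s) as [H|H].
    - exists (acos c); rewrite cos_acos, sin_acos, Hs by auto; now rewrite Rabs_pos_eq.
    - exists (- acos c); rewrite cos_neg, sin_neg, cos_acos, sin_acos, Hs by auto.
      rewrite Rabs_left by auto; lra. }
  destruct Hang as [th [Hc Hs]].
  exists (fun t => (cos (t * th), sin (t * th))); repeat split; cbn [fst snd].
  - apply (continuity_compose cos); [exact continuity_cos|auto with cont].
  - apply (continuity_compose sin); [exact continuity_sin|auto with cont].
  - intros t; apply Cmod_unique; [lra|]; cbn [fst snd].
    pose proof (sin2_cos2 (t * th)) as H; unfold Rsqr in H; nra.
  - rewrite Rmult_0_l, cos_0, sin_0; reflexivity.
  - now rewrite Rmult_1_l, Hc, Hs.
Qed.

Lemma polar (z : C) : exists e : C, Cmod e = 1 /\ z = (RtoC (Cmod z) * e)%C.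
Proof.
  destruct (Req_dec (Cmod z) 0) as [H|H].
  - exists 1%C; split; [apply Cmod_1|]. rewrite H; apply Cmod_eq_0 in H; subst; ring.
  - exists (z / RtoC (Cmod z))%C.
    assert (HC : RtoC (Cmod z) <> 0%C) by (intros E; apply H; now apply RtoC_inj).
    split; [|field; auto].
    rewrite Cmod_div by auto. rewrite Cmod_R, Rabs_pos_eq by apply Cmod_ge_0. now field.
Qed.

Lemma same_Cmod_rot (u v : C) : Cmod u = Cmod v -> exists e : C, Cmod e = 1 /\ v = (e * u)%C.
Proof.
  intros E.
  destruct (polar u) as [e [He Hu]], (polar v) as [f [Hf Hv]].
  exists (f * Cconj e)%C; split.
  - rewrite Cmod_mult, Cmod_conj, He, Hf; ring.
  - rewrite Hv, Hu at 1; rewrite <- E.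
    assert (H : (e * Cconj e = 1)%C).
    { rewrite <- Cmod2_conj, He. unfold RtoC; f_equal; ring. }
    transitivity (RtoC (Cmod u) * f * (e * Cconj e))%C; [rewrite H; ring|].
    ring.
Qed.

(* The triangle with sides [y], [z y], [l], where [z y] stays in [lo, hi] as [y] runs over
   the admissible interval; [h y] is the component of the [z]-side along the [y]-side.  The
   branch keeps [h] continuous at [y = 0]. *)
Lemma triangle_family (lo hi l : R) : 0 <= lo <= hi -> 0 < l <= hi ->
  exists z h : R -> R, continuity z /\ continuity h /\ (forall y, 0 < z y) /\
    forall y, Rmax 0 (lo - l) <= y <= hi + l ->
      lo <= z y <= hi /\ h y ^ 2 <= z y ^ 2 /\ 2 * y * h y = y ^ 2 + z y ^ 2 - l ^ 2.
Proof.
  intros Hlo Hl; destruct (Rle_lt_dec lo l) as [H|H].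
  (* The triangle is isosceles with [z = l] up to [y = 2 * l], then flat with [z = y - l]. In the
     first regime [h = y / 2], so nothing is divided by [y]. *)
  - exists (fun y => Rmax (y - l) l), (fun y => Rmax (y * / 2) (y - l)).
    splits; auto 8 with cont.
    + intros y; pose proof (Rmax_r (y - l) l); lra.
    + intros y [Hy1 Hy2]; pose proof (Rmax_l 0 (lo - l)).
      unfold Rmax at 1 2 3 4 5 6.
      destruct (Rle_dec (y - l) l), (Rle_dec (y * / 2) (y - l)); repeat split; nra.
  (* Here [y >= lo - l > 0], so the law of cosines can be divided by [y]; the [Rmax] in the
     denominator keeps it positive on the whole line. *)
  - exists (fun y => Rmax (y - l) lo),
      (fun y => (y ^ 2 + Rmax (y - l) lo ^ 2 - l ^ 2) / (2 * Rmax y (lo - l))).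
    assert (Hp : forall y, 0 < Rmax y (lo - l)).
    { intros y; pose proof (Rmax_r y (lo - l)); lra. }
    splits; auto 8 with cont.
    + apply continuity_divide; auto 8 with cont. intros t; specialize (Hp t); lra.
    + intros y; pose proof (Rmax_r (y - l) lo); lra.
    + intros y [Hy1 Hy2].
      pose proof (Rmax_r 0 (lo - l)). rewrite (Rmax_left y (lo - l)) by lra.
      assert (Hz : lo <= Rmax (y - l) lo <= hi /\ y - l <= Rmax (y - l) lo <= y + l).
      { unfold Rmax; destruct (Rle_dec (y - l) lo); lra. }
      set (z := Rmax (y - l) lo) in *. clearbody z.
      set (h := (y ^ 2 + z ^ 2 - l ^ 2) / (2 * y)).
      assert (Eh : 2 * y * h = y ^ 2 + z ^ 2 - l ^ 2) by (unfold h; field; lra).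
      split; [lra|split; [|exact Eh]].
      clearbody h.
      assert (h <= z) by nra. assert (- z <= h) by nra. nra.
Qed.

(** * Sums of edge vectors *)

Definition csum (L : list nat) (u : nat -> C) : C :=
  fold_right (fun i s => (u i + s)%C) 0%C L.

Definition rsum (L : list nat) (l : nat -> R) : R :=
  fold_right (fun i s => l i + s) 0 L.

Lemma csum_ext (L : list nat) (u v : nat -> C) :
  (forall i, In i L -> u i = v i) -> csum L u = csum L v.
Proof.
  induction L as [|i L IH]; simpl; intros H; [reflexivity|].
  rewrite (H i), IH; auto.
Qed.

Lemma csum_mult (L : list nat) (e : C) (u : nat -> C) :
  csum L (fun i => e * u i)%C = (e * csum L u)%C.
Proof. induction L as [|i L IH]; simpl; [|rewrite IH]; ring. Qed.

Lemma csum_conj (L : list nat) (u : nat -> C) :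
  csum L (fun i => Cconj (u i)) = Cconj (csum L u).
Proof.
  induction L as [|i L IH]; simpl; [|rewrite IH, Cplus_conj; reflexivity].
  unfold Cconj; simpl; now rewrite Ropp_0.
Qed.

Lemma csum_app (L M : list nat) (u : nat -> C) :
  csum (L ++ M) u = (csum L u + csum M u)%C.
Proof. induction L as [|i L IH]; simpl; [|rewrite IH]; ring. Qed.

Lemma csum_perm (L M : list nat) (u : nat -> C) : Permutation L M -> csum L u = csum M u.
Proof. induction 1; simpl; try congruence; ring. Qed.

Lemma rsum_perm (L M : list nat) (l : nat -> R) : Permutation L M -> rsum L l = rsum M l.
Proof. induction 1; simpl; try congruence; ring. Qed.

Lemma rsum_app (L M : list nat) (l : nat -> R) : rsum (L ++ M) l = rsum L l + rsum M l.
Proof. induction L as [|i L IH]; simpl; [|rewrite IH]; ring. Qed.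

Lemma rsum_nonneg (L : list nat) (l : nat -> R) :
  (forall i, In i L -> 0 < l i) -> 0 <= rsum L l.
Proof.
  induction L as [|i L IH]; simpl; intros H; [lra|].
  pose proof (H i (or_introl eq_refl)). specialize (IH (fun j Hj => H j (or_intror Hj))). lra.
Qed.

Lemma Cmod_csum_le (L : list nat) (l : nat -> R) (u : nat -> C) :
  (forall i, In i L -> Cmod (u i) = l i) -> Cmod (csum L u) <= rsum L l.
Proof.
  induction L as [|i L IH]; simpl; intros H; [rewrite Cmod_0; lra|].
  eapply Rle_trans; [apply Cmod_triangle|].
  rewrite (H i) by auto. specialize (IH (fun j Hj => H j (or_intror Hj))). lra.
Qed.

Lemma ccont_csum (L : list nat) (g : nat -> R -> C) :
  (forall i, In i L -> ccont (g i)) -> ccont (fun t => csum L (fun i => g i t)).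
Proof.
  induction L as [|i L IH]; simpl; intros H; [apply ccont_const|].
  apply ccont_plus; auto.
Qed.

Lemma Cmod_diff_le (u v w : C) : (u + v = w)%C -> Cmod u - Cmod v <= Cmod w.
Proof.
  intros <-. pose proof (Cmod_triangle (u + v) (- v)) as H.
  rewrite Cmod_opp in H. replace (u + v + - v)%C with u in H by ring. lra.
Qed.

Lemma Cmod_sum_le (u v w : C) : (u + v = w)%C -> Cmod w <= Cmod u + Cmod v.
Proof. intros <-; apply Cmod_triangle. Qed.

(** * Half fibers and sections over the whole range *)

Definition valid (l : nat -> R) (L : list nat) (a b : nat) (X : C) (u : nat -> C) : Prop :=
  (forall i, In i L -> Cmod (u i) = l i) /\ csum L u = X /\ 0 <= cross (u a) (u b).

Lemma valid_rot (l : nat -> R) L a b X u e : Cmod e = 1 ->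
  valid l L a b X u -> valid l L a b (e * X)%C (fun i => e * u i)%C.
Proof.
  intros He (H1 & H2 & H3); split; [|split].
  - intros i Hi; now rewrite Cmod_mult, He, H1, Rmult_1_l.
  - now rewrite csum_mult, H2.
  - now rewrite cross_rot.
Qed.

Lemma valid_ext (l : nat -> R) L a b X u v : In a L -> In b L ->
  (forall i, In i L -> u i = v i) -> valid l L a b X u -> valid l L a b X v.
Proof.
  intros Ha Hb E (H1 & H2 & H3); split; [|split].
  - intros i Hi; rewrite <- E; auto.
  - now rewrite <- (csum_ext L u v).
  - rewrite <- !E; auto.
Qed.

(** The total vector is the real number [y] itself, so one rotation places the section along any
    prescribed direction. *)
Definition section (l : nat -> R) (L : list nat) (a b : nat) (lo hi : R)
    (s : nat -> R -> C) : Prop :=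
  (forall i, In i L -> ccont (s i)) /\
  forall y, lo <= y <= hi -> valid l L a b (RtoC y) (fun i => s i y).

(** The new edge closes a triangle with sides [y], [z y] and [l i]. The old linkage follows its own
    section at length [z y], turned onto that side by the unit vector [e y]; a common rotation does
    not change the cross product of [a] and [b]. *)
Lemma section_cons (l : nat -> R) L a b lo hi s i :
  section l L a b lo hi s -> 0 <= lo <= hi -> In a L -> In b L -> ~ In i L ->
  0 < l i <= hi ->
  exists s', section l (i :: L) a b (Rmax 0 (lo - l i)) (hi + l i) s'.
Proof.
  intros [Hc Hv] Hlo Ha Hb Hi Hl.
  destruct (triangle_family lo hi (l i) Hlo Hl) as (z & h & Hz & Hh & Hpos & H).
  set (k := fun y => sqrt (z y ^ 2 - h y ^ 2)).
  assert (Hk : continuity k) by (unfold k; auto with cont).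
  set (e := fun y => (h y / z y, - k y / z y) : C).
  assert (Hz0 : forall y, z y <> 0) by (intros y; specialize (Hpos y); lra).
  exists (fun j y => if Nat.eq_dec j i then (y - h y, k y) else (e y * s j (z y))%C).
  split.
  - intros j Hj; destruct (Nat.eq_dec j i) as [|Hn]; [auto with cont|].
    destruct Hj as [Hj|Hj]; [congruence|].
    apply ccont_mult.
    + unfold e; apply ccont_pair; apply continuity_divide; auto with cont.
    + apply ccont_comp; auto.
  - intros y Hy.
    destruct (H y Hy) as (H1 & H2 & H3). specialize (Hpos y). specialize (Hz0 y).
    destruct (Hv (z y) H1) as (V1 & V2 & V3).
    assert (Ek : k y ^ 2 = z y ^ 2 - h y ^ 2).
    { unfold k; apply pow2_sqrt; lra. }
    assert (He : Cmod (e y) = 1).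
    { apply Cmod_unique; [lra|]; unfold e; cbn [fst snd].
      replace ((h y / z y) ^ 2 + (- k y / z y) ^ 2)
        with ((h y ^ 2 + k y ^ 2) / z y ^ 2) by (field; auto).
      rewrite Ek. field; auto. }
    assert (R0 : forall j, In j L -> j <> i) by (intros j Hj ->; auto).
    split; [|split].
    + intros j [<-|Hj].
      * destruct (Nat.eq_dec i i); [|congruence].
        apply Cmod_unique; [lra|]; cbn [fst snd]; nra.
      * destruct (Nat.eq_dec j i) as [E|_]; [now apply R0 in E|].
        now rewrite Cmod_mult, He, V1, Rmult_1_l.
    + simpl. destruct (Nat.eq_dec i i); [|congruence].
      rewrite (csum_ext L _ (fun j => e y * s j (z y))%C).
      * rewrite csum_mult, V2. unfold e, RtoC, Cplus, Cmult; cbn [fst snd].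
        f_equal; field; auto.
      * intros j Hj; destruct (Nat.eq_dec j i) as [E|_]; [now apply R0 in E|reflexivity].
    + destruct (Nat.eq_dec a i) as [E|_]; [now apply R0 in E|].
      destruct (Nat.eq_dec b i) as [E|_]; [now apply R0 in E|].
      now rewrite cross_rot.
Qed.

(** The edges are two sides of a triangle with base [y] on the real axis; their cross product is [y]
    times the height, hence nonnegative. For equal lengths the isosceles triangle has a limit at
    [y = 0], two opposite vertical edges, on which [crossing_folded] relies. *)
Lemma section_pair (l : nat -> R) a b : a <> b -> 0 < l b <= l a ->
  exists s, section l (b :: a :: nil) a b (l a - l b) (l a + l b) s /\
    (l a = l b -> fst (s a 0) = 0 /\ fst (s b 0) = 0).
Proof.
  intros Hab Hl.
  assert (Hh : exists h : R -> R, continuity h /\ (l a = l b -> h 0 = 0) /\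
     forall y, l a - l b <= y -> 2 * y * h y = y ^ 2 + l a ^ 2 - l b ^ 2 /\
       (y <= l a + l b -> h y ^ 2 <= l a ^ 2)).
  { destruct (Req_dec (l a) (l b)) as [E|E].
    - exists (fun y => y * / 2); splits; auto with cont.
      + intros _; lra.
      + intros y Hy; rewrite E; split; [field|intros; nra].
    - exists (fun y => (y ^ 2 + l a ^ 2 - l b ^ 2) / (2 * Rmax y (l a - l b))).
      splits; auto.
      + apply continuity_divide; auto 8 with cont.
        intros y; pose proof (Rmax_r y (l a - l b)); lra.
      + lra.
      + intros y Hy; rewrite (Rmax_left y) by lra.
        set (h := (y ^ 2 + l a ^ 2 - l b ^ 2) / (2 * y)).
        assert (Eh : 2 * y * h = y ^ 2 + l a ^ 2 - l b ^ 2) by (unfold h; field; lra).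
        split; [exact Eh|]. intros Hy2. clearbody h.
        assert (h <= l a) by nra. assert (- l a <= h) by nra. nra. }
  destruct Hh as (h & Hc & H0 & H).
  set (k := fun y => sqrt (l a ^ 2 - h y ^ 2)).
  exists (fun j y => if Nat.eq_dec j a then (h y, - k y) else (y - h y, k y)).
  assert (Hk : continuity k) by (unfold k; auto with cont).
  split; [split|].
  - intros j _; destruct (Nat.eq_dec j a); auto with cont.
  - intros y Hy. destruct (H y) as [H1 H2]; [lra|]. specialize (H2 (proj2 Hy)).
    assert (Ek : k y ^ 2 = l a ^ 2 - h y ^ 2) by (unfold k; apply pow2_sqrt; lra).
    assert (K0 : 0 <= k y) by apply sqrt_pos.
    unfold valid; simpl csum.
    destruct (Nat.eq_dec a a); [|congruence]. destruct (Nat.eq_dec b a); [congruence|].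
    split; [|split].
    + intros j [<-|[<-|[]]].
      * destruct (Nat.eq_dec b a); [congruence|].
        apply Cmod_unique; [lra|]; cbn [fst snd]; nra.
      * destruct (Nat.eq_dec a a); [|congruence].
        apply Cmod_unique; [lra|]; cbn [fst snd]; nra.
    + unfold RtoC, Cplus; cbn [fst snd]; f_equal; ring.
    + unfold cross; cbn [fst snd]. nra.
  - intros E. destruct (Nat.eq_dec a a); [|congruence]. destruct (Nat.eq_dec b a); [congruence|].
    cbn [fst]; rewrite H0 by auto; split; ring.
Qed.

Lemma section_app (l : nat -> R) a b M rest lo hi s :
  section l M a b lo hi s -> 0 <= lo <= hi -> In a M -> In b M ->
  NoDup (rest ++ M) -> (forall i, In i rest -> 0 < l i <= hi) ->
  exists s', section l (rest ++ M) a b (Rmax 0 (lo - rsum rest l)) (hi + rsum rest l) s'.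
Proof.
  intros Hs Hlo Ha Hb; induction rest as [|i rest IH]; simpl; intros Hnd Hl.
  - exists s. rewrite Rminus_0_r, Rplus_0_r, Rmax_right by lra. exact Hs.
  - inversion Hnd as [|? ? Hi Hnd']; subst.
    destruct IH as [s' Hs']; auto.
    assert (Hr : 0 <= rsum rest l) by (apply rsum_nonneg; intros j Hj; apply Hl; auto).
    pose proof (Hl i (or_introl eq_refl)) as Hli.
    destruct (section_cons _ _ _ _ _ _ _ i Hs') as [s'' Hs''].
    + split; [apply Rmax_l|]. apply Rmax_lub; lra.
    + apply in_or_app; auto.
    + apply in_or_app; auto.
    + auto.
    + lra.
    + exists s''. replace (hi + (l i + rsum rest l)) with (hi + rsum rest l + l i) by ring.
      replace (Rmax 0 (lo - (l i + rsum rest l))) with (Rmax 0 (Rmax 0 (lo - rsum rest l) - l i)).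
      exact Hs''.
      unfold Rmax; destruct (Rle_dec 0 (lo - rsum rest l)), (Rle_dec 0 (lo - (l i + rsum rest l)));
      match goal with |- context [Rle_dec 0 ?x] => destruct (Rle_dec 0 x) end; lra.
Qed.

(** The triangle inequality yields the very bounds of [section_exists], so that section covers every
    value taken by [theta]. *)
Lemma reach (l : nat -> R) rest a b u :
  (forall i, In i (rest ++ b :: a :: nil) -> Cmod (u i) = l i) ->
  Rmax 0 (l a - l b - rsum rest l) <= Cmod (csum (rest ++ b :: a :: nil) u)
    <= l a + l b + rsum rest l.
Proof.
  intros H1.
  assert (Hr : Cmod (csum rest u) <= rsum rest l).
  { apply Cmod_csum_le; intros i Hi; apply H1, in_or_app; auto. }
  assert (Ha : Cmod (u a) = l a) by (apply H1, in_or_app; simpl; auto).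
  assert (Hb : Cmod (u b) = l b) by (apply H1, in_or_app; simpl; auto).
  pose proof (Cmod_triangle (u a) (u b)) as T1.
  pose proof (Cmod_diff_le (u a) (u b) _ eq_refl) as T2.
  assert (E : ((u a + u b) + csum rest u = csum (rest ++ b :: a :: nil) u)%C).
  { rewrite csum_app; simpl; ring. }
  pose proof (Cmod_sum_le _ _ _ E). pose proof (Cmod_diff_le _ _ _ E).
  split; [apply Rmax_lub; [apply Cmod_ge_0|]|]; lra.
Qed.

Lemma section_exists (l : nat -> R) rest a b :
  0 < l b <= l a -> (forall i, In i rest -> 0 < l i <= l b) ->
  NoDup (rest ++ b :: a :: nil) ->
  exists s, section l (rest ++ b :: a :: nil) a b
    (Rmax 0 (l a - l b - rsum rest l)) (l a + l b + rsum rest l) s.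
Proof.
  intros Hab Hl Hnd.
  assert (Hne : a <> b).
  { apply NoDup_app_remove_l in Hnd. inversion Hnd as [|? ? Hin]; subst.
    intros ->; apply Hin; simpl; auto. }
  destruct (section_pair l a b Hne Hab) as (s & Hs & _).
  apply section_app with s; simpl; auto; [lra|].
  intros i Hi; specialize (Hl i Hi); lra.
Qed.

(** * Path connectedness of half fibers *)

(** Validity is asked at every real time, so that reparametrising a path creates no side
    condition. *)
Definition joined (l : nat -> R) (L : list nat) (a b : nat) (X : C) (u v : nat -> C) : Prop :=
  exists g : nat -> R -> C, (forall i, In i L -> ccont (g i)) /\
    (forall t, valid l L a b X (fun i => g i t)) /\
    forall i, In i L -> g i 0 = u i /\ g i 1 = v i.

Definition clamp (lo hi t : R) : R := Rmax lo (Rmin hi t).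

Lemma continuity_clamp (lo hi : R) (f : R -> R) :
  continuity f -> continuity (fun t => clamp lo hi (f t)).
Proof. unfold clamp; auto with cont. Qed.

Lemma clamp_bounds (lo hi t : R) : lo <= hi -> lo <= clamp lo hi t <= hi.
Proof.
  intros H; unfold clamp, Rmax, Rmin.
  destruct (Rle_dec hi t); destruct (Rle_dec lo _); lra.
Qed.

Lemma clamp_id (lo hi t : R) : lo <= t <= hi -> clamp lo hi t = t.
Proof. intros H; unfold clamp; rewrite Rmin_right, Rmax_right; lra. Qed.

Lemma clamp_low (lo hi t : R) : lo <= hi -> t <= lo -> clamp lo hi t = lo.
Proof. intros H H'; unfold clamp; rewrite Rmin_right, Rmax_left; lra. Qed.

Lemma clamp_high (lo hi t : R) : lo <= hi -> hi <= t -> clamp lo hi t = hi.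
Proof. intros H H'; unfold clamp; rewrite Rmin_left, Rmax_right; lra. Qed.

#[local] Hint Resolve continuity_clamp : cont.

Lemma joined_sym (l : nat -> R) L a b X u v :
  joined l L a b X u v -> joined l L a b X v u.
Proof.
  intros (g & H1 & H2 & H3). exists (fun i t => g i (1 - t)); split; [|split].
  - intros i Hi; apply ccont_comp; auto with cont.
  - intros t; apply (H2 (1 - t)).
  - intros i Hi; destruct (H3 i Hi) as [E0 E1].
    rewrite Rminus_0_r, Rminus_diag; auto.
Qed.

(* Concatenating two paths as a sum makes the result continuous without a case split. *)
Lemma joined_trans (l : nat -> R) L a b X u v w : In a L -> In b L ->
  joined l L a b X u v -> joined l L a b X v w -> joined l L a b X u w.
Proof.
  intros Ha Hb (g & G1 & G2 & G3) (h & H1 & H2 & H3).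
  exists (fun i t => g i (Rmin 1 (2 * t)) + h i (Rmax 0 (2 * t - 1)) - v i)%C.
  split; [|split].
  - intros i Hi; apply ccont_minus; [apply ccont_plus|]; auto with cont;
      apply ccont_comp; auto with cont.
  - intros t. destruct (Rle_dec t (/ 2)) as [Ht|Ht].
    + apply valid_ext with (fun i => g i (2 * t)); auto.
      intros i Hi; rewrite Rmin_right, Rmax_left by lra.
      destruct (H3 i Hi) as [-> _]; ring.
    + apply valid_ext with (fun i => h i (2 * t - 1)); auto.
      intros i Hi; rewrite Rmin_left, Rmax_right by lra.
      destruct (G3 i Hi) as [_ ->]; ring.
  - intros i Hi; destruct (G3 i Hi) as [G0 G4], (H3 i Hi) as [H0 H4]; split.
    + rewrite Rmin_right, Rmax_left by lra. rewrite Rmult_0_r, G0, H0; ring.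
    + rewrite Rmin_left, Rmax_right by lra.
      replace (2 * 1 - 1) with 1 by ring. rewrite G4, H4; ring.
Qed.

Lemma joined_eq (l : nat -> R) L a b X u v : In a L -> In b L ->
  valid l L a b X u -> (forall i, In i L -> u i = v i) -> joined l L a b X u v.
Proof.
  intros Ha Hb Hu E; exists (fun i _ => u i); repeat split; auto with cont; apply Hu.
Qed.

Lemma joined_cons (l : nat -> R) L a b X u v i : In a L -> In b L -> ~ In i L ->
  Cmod (u i) = l i -> u i = v i ->
  joined l L a b (X - u i)%C u v -> joined l (i :: L) a b X u v.
Proof.
  intros Ha Hb Hi Hu E (g & H1 & H2 & H3).
  assert (R0 : forall j, In j L -> j <> i) by (intros j Hj ->; auto).
  exists (fun j t => if Nat.eq_dec j i then u i else g j t); split; [|split].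
  - intros j [<-|Hj]; [destruct (Nat.eq_dec i i); [|congruence]; apply ccont_const|].
    destruct (Nat.eq_dec j i); [apply ccont_const|auto].
  - intros t. destruct (H2 t) as (V1 & V2 & V3). split; [|split].
    + intros j Hj. destruct (Nat.eq_dec j i) as [->|Hn]; [auto|].
      destruct Hj; [congruence|auto].
    + simpl. destruct (Nat.eq_dec i i); [|congruence].
      rewrite (csum_ext L _ (fun j => g j t)), V2; [ring|].
      intros j Hj; destruct (Nat.eq_dec j i) as [E'|_]; [now apply R0 in E'|reflexivity].
    + destruct (Nat.eq_dec a i) as [E'|_]; [now apply R0 in E'|].
      destruct (Nat.eq_dec b i) as [E'|_]; [now apply R0 in E'|auto].
  - intros j Hj; destruct (Nat.eq_dec j i) as [->|Hn]; [auto|].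
    destruct Hj as [Hj|Hj]; [congruence|auto].
Qed.

(* The distance [y] varies monotonically, hence stays in the interval.  The direction [f] has
   to remain continuous when [y] vanishes, which happens if [Cmod X = l]. *)
Lemma turn_edge (X : C) (l lo hi : R) : 0 < l -> 0 <= lo ->
  Cmod X + l <= hi \/ lo <= Rabs (Cmod X - l) ->
  exists U1 : C, forall U0 : C, Cmod U0 = l -> lo <= Cmod (X - U0)%C <= hi ->
  exists (U : R -> C) (y : R -> R) (f : R -> C),
    ccont U /\ continuity y /\ ccont f /\ U 0 = U0 /\ U 1 = U1 /\
    forall t, Cmod (U t) = l /\ Cmod (f t) = 1 /\ lo <= y t <= hi /\
      (U t + RtoC (y t) * f t)%C = X.
Proof.
  intros Hl Hlo Hcase.
  destruct (Req_dec (Cmod X) 0) as [HX|HX].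
  (* For [X = 0] the other edges always sum to [- U0], of length [l]; a rotation of the whole brings
     the edge to any target on its circle. *)
  - exists (RtoC l). intros U0 HU Hd.
    apply Cmod_eq_0 in HX; subst X.
    replace (0 - U0)%C with (- U0)%C in Hd by ring. rewrite Cmod_opp, HU in Hd.
    destruct (same_Cmod_rot U0 (RtoC l)) as (e & He & Ee).
    { now rewrite HU, Cmod_R, Rabs_pos_eq by lra. }
    destruct (rotation_path e He) as (g & G1 & G2 & G3 & G4).
    exists (fun t => g t * U0)%C, (fun _ => l), (fun t => RtoC (- / l) * (g t * U0))%C.
    splits; auto with cont.
    + cbv beta; rewrite G3; ring.
    + cbv beta; now rewrite G4, Ee.
    + intros t. assert (HgU : Cmod (g t * U0)%C = l) by (rewrite Cmod_mult, G2, HU; ring).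
      splits; auto; try lra.
      * rewrite Cmod_mult, HgU, Cmod_R, Rabs_Ropp, Rabs_pos_eq.
        -- field; lra.
        -- left; now apply Rinv_0_lt_compat.
      * rewrite Cmult_assoc, <- RtoC_mult. replace (l * - / l) with (-1) by (field; lra).
        unfold RtoC; apply injective_projections; simpl; ring.
  - pose proof (Cmod_ge_0 X) as HX0. set (x := Cmod X) in *.
    destruct (polar X) as (e & He & EX). fold x in EX.
    (* The target points against [X] if the other edges can reach length [x + l], and along [X]
       otherwise. It does not depend on [U0], so any two placements of the fiber end with the same
       edge. *)
    pose (h1 := if Rle_dec (x + l) hi then - l else l).
    assert (Hh1 : h1 = - l /\ x + l <= hi \/ h1 = l /\ lo <= Rabs (x - l)).
    { unfold h1; destruct (Rle_dec (x + l) hi); [auto|right; split; [auto|]].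
      destruct Hcase; [lra|auto]. }
    clearbody h1.
    exists (e * RtoC h1)%C. intros U0 HU Hd.
    pose (p := (Cconj e * U0)%C).
    assert (Ee : (e * Cconj e = 1)%C).
    { rewrite <- Cmod2_conj, He. unfold RtoC; f_equal; ring. }
    assert (EU : U0 = (e * p)%C) by (unfold p; rewrite Cmult_assoc, Ee; ring).
    assert (Hp : fst p ^ 2 + snd p ^ 2 = l ^ 2).
    { rewrite <- Cmod_sqr. unfold p. now rewrite Cmod_mult, Cmod_conj, He, HU, Rmult_1_l. }
    assert (Hy0 : Cmod (X - U0)%C ^ 2 = x ^ 2 + l ^ 2 - 2 * x * fst p).
    { rewrite EX, EU. replace (RtoC x * e - e * p)%C with (e * (RtoC x - p))%C by ring.
      rewrite Cmod_mult, He, Rmult_1_l, Cmod_sqr, <- Hp; simpl; ring. }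
    set (h0 := fst p) in *. set (y0 := Cmod (X - U0)%C) in *.
    assert (Hh0 : - l <= h0 <= l) by nra.
    pose (h := fun t => h0 + (h1 - h0) * clamp 0 1 t).
    assert (Hh : forall t, - l <= h t <= l /\
       (h1 = - l -> h t <= h0) /\ (h1 = l -> h0 <= h t)).
    { intros t; unfold h; pose proof (clamp_bounds 0 1 t Rle_0_1) as B.
      set (c := clamp 0 1 t) in *; clearbody c.
      destruct Hh1 as [[-> _]|[-> _]]; repeat split; nra. }
    (* The sign records the side of [X] on which the edge starts; the path never leaves that closed
       side, as only [h] is interpolated. *)
    assert (Hsg : exists sg : R, sg ^ 2 = 1 /\ snd p = sg * sqrt (l ^ 2 - h0 ^ 2)).
    { assert (Es : sqrt (l ^ 2 - h0 ^ 2) = Rabs (snd p)).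
      { replace (l ^ 2 - h0 ^ 2) with (Rsqr (snd p)) by (unfold Rsqr; lra). apply sqrt_Rsqr_abs. }
      rewrite Es. destruct (Rle_lt_dec 0 (snd p)) as [H|H].
      - exists 1; rewrite Rabs_pos_eq by auto; lra.
      - exists (-1); rewrite Rabs_left by auto; lra. }
    destruct Hsg as (sg & Hsg & Esg).
    pose (k := fun t => sg * sqrt (l ^ 2 - h t ^ 2)).
    pose (y := fun t => sqrt (x ^ 2 + l ^ 2 - 2 * x * h t)).
    assert (Ch : continuity h) by (unfold h; auto with cont).
    assert (Ck : continuity k) by (unfold k; auto with cont).
    assert (Cy : continuity y) by (unfold y; auto with cont).
    assert (Hk2 : forall t, k t ^ 2 = l ^ 2 - h t ^ 2).
    { intros t; destruct (Hh t) as [B _]. unfold k. rewrite Rpow_mult_distr, Hsg, pow2_sqrt; nra. }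
    assert (Hy2 : forall t, y t ^ 2 = x ^ 2 + l ^ 2 - 2 * x * h t).
    { intros t; destruct (Hh t) as [B _]. unfold y. apply pow2_sqrt.
      pose proof (pow2_ge_0 (x - l)); nra. }
    assert (Hyp : forall t, 0 <= y t) by (intros; apply sqrt_pos).
    assert (Hf : exists f : R -> C, ccont f /\ forall t, Cmod (f t) = 1 /\
      h t + y t * fst (f t) = x /\ k t + y t * snd (f t) = 0).
    { destruct (Req_dec x l) as [Exl|Exl].
      (* For [x = l] the length [y] vanishes when the edge coincides with [X]. Since
         [y ^ 2 = 2 * l * (l - h)], the quotient [(l - h) / y] equals [y / (2 * l)], and the other
         coordinate simplifies likewise: a half-angle formula without division by [y]. *)
      - exists (fun t => (y t / (2 * l), - (sg * sqrt ((l + h t) / (2 * l))))).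
        split.
        + apply ccont_pair.
          * apply continuity_divide; auto with cont; intros; lra.
          * apply continuity_neg, continuity_mul; auto with cont.
            apply continuity_root, continuity_divide; auto with cont; intros; lra.
        + intros t; cbn [fst snd]. destruct (Hh t) as [B _]. specialize (Hy2 t).
          assert (Q0 : 0 <= (l + h t) / (2 * l)).
          { apply Rmult_le_pos; [lra|]. left; apply Rinv_0_lt_compat; lra. }
          split; [|split].
          * apply Cmod_unique; [lra|]; cbn [fst snd].
            replace ((- (sg * sqrt ((l + h t) / (2 * l)))) ^ 2)
              with (sg ^ 2 * sqrt ((l + h t) / (2 * l)) ^ 2) by ring.
            rewrite Hsg, pow2_sqrt by auto.
            replace ((y t / (2 * l)) ^ 2) with (y t ^ 2 / (4 * l ^ 2)) by (field; lra).
            rewrite Hy2, Exl. field; lra.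
          * replace (y t * (y t / (2 * l))) with (y t ^ 2 / (2 * l)) by (field; lra).
            rewrite Hy2, Exl. field; lra.
          * assert (Q : sqrt (l ^ 2 - h t ^ 2) = y t * sqrt ((l + h t) / (2 * l))).
            { unfold y. rewrite <- sqrt_mult; [|rewrite Exl; nra|auto].
              f_equal. rewrite Exl; field; lra. }
            unfold k; rewrite Q; ring.
      - assert (Hy1 : forall t, y t <> 0).
        { intros t E; specialize (Hy2 t); rewrite E in Hy2. destruct (Hh t) as [B _].
          assert (0 < (x - l) ^ 2) by (apply pow2_gt_0; lra). nra. }
        exists (fun t => ((x - h t) / y t, - k t / y t)); split.
        + apply ccont_pair; apply continuity_divide; auto with cont.
        + intros t; cbn [fst snd]; specialize (Hy1 t); split; [|split; field; auto].
          apply Cmod_unique; [lra|]; cbn [fst snd].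
          replace (((x - h t) / y t) ^ 2 + (- k t / y t) ^ 2)
            with (((x - h t) ^ 2 + k t ^ 2) / y t ^ 2) by (field; auto).
          rewrite Hk2. specialize (Hy2 t).
          replace ((x - h t) ^ 2 + (l ^ 2 - h t ^ 2)) with (y t ^ 2) by (rewrite Hy2; ring).
          field; auto. }
    destruct Hf as (f & Cf & Hf).
    exists (fun t => e * (h t, k t))%C, y, (fun t => e * f t)%C.
    splits; auto with cont.
    + rewrite EU; f_equal. unfold k, h. rewrite clamp_low by lra.
      replace (h0 + (h1 - h0) * 0) with h0 by ring. rewrite <- Esg.
      unfold h0; now destruct p.
    + f_equal. unfold k, h. rewrite clamp_high by lra.
      replace (h0 + (h1 - h0) * 1) with h1 by ring.
      replace (l ^ 2 - h1 ^ 2) with 0 by (destruct Hh1 as [[-> _]|[-> _]]; ring).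
      rewrite sqrt_0. unfold RtoC; f_equal; ring.
    + intros t. destruct (Hf t) as (F1 & F2 & F3). splits.
      * rewrite Cmod_mult, He, Rmult_1_l. apply Cmod_unique; [lra|]; cbn [fst snd].
        rewrite Hk2; ring.
      * rewrite Cmod_mult, He, F1; ring.
      * destruct (Hh t) as (B & B1 & B2). specialize (Hy2 t). apply Rsqr_le_inv; [auto|].
        destruct Hh1 as [[E1 Hx]|[E1 Hx]].
        -- specialize (B1 E1). assert (lo ^ 2 <= y0 ^ 2) by nra. nra.
        -- assert (lo ^ 2 <= (x - l) ^ 2).
           { rewrite <- (pow2_abs (x - l)). nra. }
           nra.
      * destruct (Hh t) as (B & B1 & B2). specialize (Hy2 t). apply Rsqr_le_inv; [lra|].
        destruct Hh1 as [[E1 Hx]|[E1 Hx]].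
        -- assert ((x + l) ^ 2 <= hi ^ 2) by nra. nra.
        -- specialize (B2 E1). assert (y0 ^ 2 <= hi ^ 2) by nra. nra.
      * rewrite EX.
        replace (e * (h t, k t) + RtoC (y t) * (e * f t))%C
          with (e * ((h t, k t) + RtoC (y t) * f t))%C by ring.
        replace ((h t, k t) + RtoC (y t) * f t)%C with (RtoC x); [ring|].
        symmetry. unfold RtoC, Cplus, Cmult; cbn [fst snd]. f_equal; lra.
Qed.

(** For [X <> 0] the placement is unique: the law of cosines fixes the component of [u a] along [X],
    its length fixes the other one up to sign, and [cross (u a) (u b) = cross (u a) X] fixes the
    sign. For [X = 0] the edges are opposite and two placements differ by a rotation. *)
Lemma pair_joined (l : nat -> R) a b X u v : a <> b -> 0 < l b <= l a ->
  valid l (b :: a :: nil) a b X u -> valid l (b :: a :: nil) a b X v ->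
  joined l (b :: a :: nil) a b X u v.
Proof.
  intros Hab Hl Hu Hv.
  pose proof Hu as (U1 & U2 & U3). pose proof Hv as (V1 & V2 & V3). simpl in U2, V2.
  assert (Ha : Cmod (u a) = Cmod (v a)) by (rewrite U1, V1; simpl; auto).
  assert (Eu : u b = (X - u a)%C) by (rewrite <- U2; ring).
  assert (Ev : v b = (X - v a)%C) by (rewrite <- V2; ring).
  destruct (Req_dec (Cmod X) 0) as [HX|HX].
  - apply Cmod_eq_0 in HX; clear U2 V2; subst X.
    destruct (same_Cmod_rot _ _ Ha) as (e & He & Ee).
    destruct (rotation_path e He) as (g & G1 & G2 & G3 & G4).
    exists (fun i t => g t * u i)%C; split; [|split].
    + intros; auto with cont.
    + intros t. pose proof (valid_rot l _ a b 0%C u (g t) (G2 t) Hu) as H.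
      now rewrite Cmult_0_r in H.
    + assert (Q : forall i, In i (b :: a :: nil) -> v i = (e * u i)%C).
      { intros i [<-|[<-|[]]]; auto. rewrite Ev, Eu, Ee; ring. }
      intros i Hi. rewrite G3, G4, (Q i Hi); split; ring.
  - assert (E : u a = v a).
    { assert (B1 : Cmod (X - u a)%C ^ 2 = l b ^ 2) by (rewrite <- Eu, U1; simpl; auto).
      assert (B2 : Cmod (X - v a)%C ^ 2 = l b ^ 2) by (rewrite <- Ev, V1; simpl; auto).
      assert (A1 : Cmod (u a) ^ 2 = Cmod (v a) ^ 2) by (rewrite Ha; auto).
      assert (HXp : 0 < Cmod X ^ 2) by (apply pow2_gt_0; auto).
      rewrite !Cmod_sqr in *. rewrite Eu in U3. rewrite Ev in V3. unfold cross in *.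
      destruct (u a) as [p q], (v a) as [p' q'], X as [x1 x2]; cbn [fst snd Cminus Cplus Copp] in *.
      assert (D : p * x1 + q * x2 = p' * x1 + q' * x2) by nra.
      assert (K : p * x2 - q * x1 = p' * x2 - q' * x1).
      { assert (S : (p * x2 - q * x1) ^ 2 = (p' * x2 - q' * x1) ^ 2).
        { transitivity ((p ^ 2 + q ^ 2) * (x1 ^ 2 + x2 ^ 2) - (p * x1 + q * x2) ^ 2); [ring|].
          rewrite A1, D; ring. }
        assert (0 <= p * x2 - q * x1) by nra. assert (0 <= p' * x2 - q' * x1) by nra.
        apply Rle_antisym; apply Rsqr_le_inv; lra. }
      assert ((p - p') * (x1 ^ 2 + x2 ^ 2) = 0).
      { transitivity (((p * x1 + q * x2) - (p' * x1 + q' * x2)) * x1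
          + ((p * x2 - q * x1) - (p' * x2 - q' * x1)) * x2); [ring|]. rewrite D, K; ring. }
      assert ((q - q') * (x1 ^ 2 + x2 ^ 2) = 0).
      { transitivity (((p * x1 + q * x2) - (p' * x1 + q' * x2)) * x2
          - ((p * x2 - q * x1) - (p' * x2 - q' * x1)) * x1); [ring|]. rewrite D, K; ring. }
      f_equal; nra. }
    apply joined_eq; simpl; auto. intros i [<-|[<-|[]]]; auto. rewrite Eu, Ev, E; auto.
Qed.

(** The induction hypothesis is used twice with edge [i] held still: to bring the other edges onto
    the rotated section before the turn, and to join the two placements once both have [U1] as edge
    [i]. *)
Lemma half_fiber_joined (l : nat -> R) rest a b :
  0 < l b <= l a -> (forall i, In i rest -> 0 < l i <= l b) ->
  NoDup (rest ++ b :: a :: nil) -> forall X u v,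
  valid l (rest ++ b :: a :: nil) a b X u -> valid l (rest ++ b :: a :: nil) a b X v ->
  joined l (rest ++ b :: a :: nil) a b X u v.
Proof.
  intros Hab; induction rest as [|i rest IH]; intros Hl Hnd X u v Hu Hv.
  - apply pair_joined; auto. simpl in Hnd; inversion Hnd as [|? ? Hin]; subst.
    intros ->; apply Hin; simpl; auto.
  - simpl in Hnd |- *. set (M := rest ++ b :: a :: nil) in *.
    inversion Hnd as [|? ? Hi Hnd']; subst.
    assert (Hl' : forall j, In j rest -> 0 < l j <= l b) by (intros; apply Hl; simpl; auto).
    specialize (IH Hl' Hnd').
    destruct (section_exists l rest a b Hab Hl' Hnd') as [s [Sc Sv]]. fold M in Sc, Sv.
    assert (Ha : In a M) by (apply in_or_app; simpl; auto).
    assert (Hb : In b M) by (apply in_or_app; simpl; auto).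
    assert (R0 : forall j, In j M -> j <> i) by (intros j Hj ->; auto).
    pose proof (Hl i (or_introl eq_refl)) as Hli.
    assert (Hr : 0 <= rsum rest l) by (apply rsum_nonneg; intros j Hj; apply Hl'; auto).
    set (lo := Rmax 0 (l a - l b - rsum rest l)) in *.
    set (hi := l a + l b + rsum rest l) in *.
    destruct (turn_edge X (l i) lo hi) as [U1 HU1].
    + lra.
    + apply Rmax_l.
    + pose proof (Cmod_ge_0 X). unfold lo, hi, Rmax, Rabs.
      destruct (Rle_dec 0 (l a - l b - rsum rest l)), (Rcase_abs (Cmod X - l i)); lra.
    + assert (Q : forall w, valid l (i :: M) a b X w ->
        exists w', valid l (i :: M) a b X w' /\ w' i = U1 /\ joined l (i :: M) a b X w w').
      { intros w (W1 & W2 & W3). simpl in W2.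
        assert (HwM : valid l M a b (X - w i)%C w).
        { split; [|split]; auto; [intros; apply W1; simpl; auto|]. rewrite <- W2; ring. }
        destruct (HU1 (w i)) as (U & y & f & CU & Cy & Cf & E0 & E1 & H).
        { apply W1; simpl; auto. }
        { destruct HwM as (M1 & <- & _). apply reach; auto. }
        pose (g := fun j t => if Nat.eq_dec j i then U t else (f t * s j (y t))%C).
        assert (Gi : forall t, g i t = U t).
        { intros t; unfold g; destruct (Nat.eq_dec i i); congruence. }
        assert (GM : forall j t, In j M -> g j t = (f t * s j (y t))%C).
        { intros j t Hj; unfold g; destruct (Nat.eq_dec j i) as [E|_];
            [now apply R0 in E|reflexivity]. }
        assert (GV : forall t, valid l M a b (X - U t)%C (fun j => g j t)).
        { intros t; destruct (H t) as (T1 & T2 & T3 & T4).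
          apply valid_ext with (fun j => f t * s j (y t))%C; auto.
          { intros j Hj; now rewrite GM. }
          replace (X - U t)%C with (f t * RtoC (y t))%C by (rewrite <- T4; ring).
          apply (valid_rot l M a b _ (fun j => s j (y t))); auto. }
        assert (GV' : forall t, valid l (i :: M) a b X (fun j => g j t)).
        { intros t; destruct (GV t) as (T1 & T2 & T3). split; [|split]; auto.
          - intros j [<-|Hj]; [rewrite Gi; apply H|auto].
          - simpl. rewrite T2, Gi; ring. }
        exists (fun j => g j 1); split; [apply GV'|split; [now rewrite Gi|]].
        apply joined_trans with (fun j => g j 0); simpl; auto.
        - apply joined_cons; auto.
          + apply W1; simpl; auto.
          + now rewrite Gi.
          + apply IH; auto. rewrite <- E0. apply GV.
        - exists g; split; [|split; [exact GV'|auto]].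
          intros j [<-|Hj].
          + apply ccont_ext with U; auto.
          + apply ccont_ext with (fun t => f t * s j (y t))%C.
            * intros t; now rewrite GM.
            * apply ccont_mult; auto; apply ccont_comp; auto. }
      destruct (Q u Hu) as (u' & Vu & Eu & Ju), (Q v Hv) as (v' & Vv & Ev & Jv).
      apply joined_trans with u'; simpl; auto.
      apply joined_trans with v'; simpl; auto; [|now apply joined_sym].
      assert (QM : forall w, valid l (i :: M) a b X w -> valid l M a b (X - w i)%C w).
      { intros w (W1 & W2 & W3). split; [|split]; auto; [intros; apply W1; simpl; auto|].
        rewrite <- W2; simpl; ring. }
      apply joined_cons; auto.
      * apply Vu; simpl; auto.
      * congruence.
      * apply IH; [auto|]. rewrite Eu, <- Ev; auto.
Qed.

(** * Two sections that meet over a given value *)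

Lemma extract_max (l : nat -> R) (L : list nat) : L <> nil ->
  exists c M, Permutation L (c :: M) /\ forall i, In i M -> l i <= l c.
Proof.
  induction L as [|i L IH]; [congruence|intros _].
  destruct L as [|j L]; [exists i, nil; split; [auto|intros k []]|].
  destruct IH as (c & M & HP & HM); [congruence|].
  destruct (Rle_lt_dec (l i) (l c)) as [H|H].
  - exists c, (i :: M); split.
    + rewrite HP; apply perm_swap.
    + intros k [<-|Hk]; auto.
  - exists i, (c :: M); split; [now rewrite HP|].
    intros k [<-|Hk]; [lra|]. specialize (HM k Hk); lra.
Qed.

(** The least total [m] is the excess of the longest edge over the sum of the others, or 0 if there
    is none. *)
Lemma rest_section (l : nat -> R) (rest : list nat) :
  (forall i, In i rest -> 0 < l i) -> NoDup rest ->
  exists (m : R) (T : nat -> R -> C), 0 <= m <= rsum rest l /\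
    (forall B, 0 <= B -> (forall i, In i rest -> l i <= B) -> m <= B) /\
    (forall u, (forall i, In i rest -> Cmod (u i) = l i) -> m <= Cmod (csum rest u)) /\
    (forall i, In i rest -> ccont (T i)) /\
    forall w, m <= w <= rsum rest l ->
      (forall i, In i rest -> Cmod (T i w) = l i) /\ csum rest (fun i => T i w) = RtoC w.
Proof.
  intros Hl Hnd.
  destruct (list_eq_dec Nat.eq_dec rest nil) as [->|Hne].
  - exists 0, (fun _ _ => 0%C); simpl; splits; try tauto; try lra.
    + intros u _; apply Cmod_ge_0.
    + intros w Hw; split; [tauto|]. now replace w with 0 by lra.
  - destruct (extract_max l rest Hne) as (c & M & HP & HM).
    assert (HP' : Permutation rest (M ++ c :: nil)).
    { rewrite HP; apply Permutation_cons_append. }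
    assert (Hin : forall i, In i rest <-> In i (M ++ c :: nil)).
    { intros i; split; apply Permutation_in; auto using Permutation_sym. }
    assert (Hc : 0 < l c) by (apply Hl, Hin, in_or_app; simpl; auto).
    assert (HMl : forall i, In i M -> 0 < l i <= l c).
    { intros i Hi; split; auto. apply Hl, Hin, in_or_app; auto. }
    (* A single edge is a section over one point. With [c] in both distinguished roles the cross
       product is zero, so [section_app] can be reused. *)
    assert (H0 : section l (c :: nil) c c (l c) (l c) (fun _ _ => RtoC (l c))).
    { split; [intros; apply ccont_const|]. intros y Hy. replace y with (l c) by lra.
      split; [|split].
      - intros i [<-|[]]. rewrite Cmod_R; apply Rabs_pos_eq; lra.
      - simpl; ring.
      - unfold cross; lra. }
    destruct (section_app l c c (c :: nil) M _ _ _ H0) as [T [T1 T2]]; simpl; auto; try lra.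
    { apply (Permutation_NoDup HP'); auto. }
    assert (ES : rsum rest l = l c + rsum M l).
    { rewrite (rsum_perm _ _ l HP'), rsum_app; simpl; ring. }
    rewrite ES.
    assert (Hs : 0 <= rsum M l) by (apply rsum_nonneg; intros i Hi; apply HMl; auto).
    exists (Rmax 0 (l c - rsum M l)), T; splits.
    + apply Rmax_l.
    + apply Rmax_lub; lra.
    + intros B HB HlB. assert (l c <= B) by (apply HlB, Hin, in_or_app; simpl; auto).
      apply Rmax_lub; lra.
    + intros u Hu. apply Rmax_lub; [apply Cmod_ge_0|].
      rewrite (csum_perm _ _ u HP); simpl.
      pose proof (Cmod_diff_le (u c) (csum M u) _ eq_refl) as H.
      assert (HH : Cmod (csum M u) <= rsum M l).
      { apply Cmod_csum_le; intros i Hi; apply Hu, Hin, in_or_app; auto. }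
      rewrite (Hu c) in H by (apply Hin, in_or_app; simpl; auto). lra.
    + intros i Hi; apply T1, Hin; auto.
    + intros w Hw. destruct (T2 w Hw) as (V1 & V2 & _); split.
      * intros i Hi; apply V1, Hin; auto.
      * now rewrite (csum_perm _ _ _ HP').
Qed.

(** Total vectors are prescribed in modulus only, which is all that [theta] sees. At [x0] the
    sections agree edge by edge, so that changing from one to the other requires no rotation. *)
Definition crossing (l : nat -> R) (L : list nat) (a b : nat) (lo hi x0 : R) : Prop :=
  exists sp sm : nat -> R -> C,
    (forall i, In i L -> ccont (sp i) /\ ccont (sm i)) /\
    (forall x, lo <= x <= hi ->
       (forall i, In i L -> Cmod (sp i x) = l i /\ Cmod (sm i x) = l i) /\
       Cmod (csum L (fun i => sp i x)) = x /\ Cmod (csum L (fun i => sm i x)) = x /\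
       0 <= cross (sp a x) (sp b x) /\ cross (sm a x) (sm b x) <= 0) /\
    forall i, In i L -> sp i x0 = sm i x0.

(* The pair [(a, b)] has total length [r x] and the remaining edges total length [w x], with
   an angle of cosine [c x] between the two directions.  Reflecting the pair in its own axis
   ([k = -1]) or in the direction of the remaining edges ([k = 1]) flips the sign of the
   cross product. *)
Lemma crossing_of_triangle (l : nat -> R) rest a b lo hi m (T s : nat -> R -> C)
    (r w c : R -> R) (k x0 : R) :
  NoDup (rest ++ b :: a :: nil) ->
  (forall i, In i rest -> ccont (T i)) ->
  (forall w, m <= w <= rsum rest l ->
      (forall i, In i rest -> Cmod (T i w) = l i) /\ csum rest (fun i => T i w) = RtoC w) ->
  section l (b :: a :: nil) a b (l a - l b) (l a + l b) s ->
  continuity r -> continuity w -> continuity c ->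
  (forall x, lo <= x <= hi -> 0 <= x /\ l a - l b <= r x <= l a + l b /\
     m <= w x <= rsum rest l /\ -1 <= c x <= 1 /\
     x ^ 2 = r x ^ 2 + w x ^ 2 + 2 * r x * w x * c x) ->
  (k = -1 /\ snd (s a (r x0)) = 0 /\ snd (s b (r x0)) = 0 \/
   k = 1 /\ c x0 = 0 /\ fst (s a (r x0)) = 0 /\ fst (s b (r x0)) = 0) ->
  crossing l (rest ++ b :: a :: nil) a b lo hi x0.
Proof.
  intros Hnd CT HT [Cs Hs] Cr Cw Cc H Hk.
  assert (Hk2 : k ^ 2 = 1) by (destruct Hk as [[-> _]|[-> _]]; ring).
  set (d := fun x => sqrt (1 - c x ^ 2)).
  assert (Cd : continuity d) by (unfold d; auto with cont).
  pose (pm := fun x => (c x, - d x) : C). pose (pk := fun x => (c x, k * d x) : C).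
  set (P := b :: a :: nil) in *.
  assert (HnP : forall i, In i rest -> ~ In i P).
  { intros i Hi Hi'. apply in_split in Hi; destruct Hi as (M & N & ->).
    rewrite <- app_assoc in Hnd; simpl in Hnd. apply NoDup_remove_2 in Hnd.
    apply Hnd, in_or_app; right; apply in_or_app; auto. }
  pose (sp := fun i x => if in_dec Nat.eq_dec i P
     then (s i (r x) * pm x)%C else T i (w x)).
  pose (sm := fun i x => if in_dec Nat.eq_dec i P
     then (Cconj (s i (r x)) * pk x)%C else T i (w x)).
  assert (PP : forall i x, In i P -> sp i x = (s i (r x) * pm x)%C /\
     sm i x = (Cconj (s i (r x)) * pk x)%C).
  { intros i x Hi; unfold sp, sm; destruct (in_dec Nat.eq_dec i P); tauto. }
  assert (PR : forall i x, In i rest -> sp i x = T i (w x) /\ sm i x = T i (w x)).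
  { intros i x Hi; unfold sp, sm; destruct (in_dec Nat.eq_dec i P) as [F|]; [|tauto].
    now apply HnP in F. }
  assert (IP : forall i, In i (rest ++ P) -> In i P \/ In i rest).
  { intros i Hi; apply in_app_or in Hi; tauto. }
  assert (Pa : In a P) by (simpl; auto). assert (Pb : In b P) by (simpl; auto).
  assert (Cm : ccont pm) by (unfold pm; auto with cont).
  assert (Ck : ccont pk) by (unfold pk; auto with cont).
  exists sp, sm; split; [|split].
  - intros i Hi. unfold sp, sm. destruct (in_dec Nat.eq_dec i P) as [F|F].
    + assert (ccont (fun x => s i (r x))) by (apply ccont_comp; auto).
      split; auto 8 with cont.
    + destruct (IP i Hi) as [|Hi']; [tauto|].
      assert (ccont (fun x => T i (w x))) by (apply ccont_comp; auto). auto.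
  - intros x Hx. destruct (H x Hx) as (Hx0 & Hr & Hw & Hc & E).
    destruct (Hs (r x) Hr) as (V1 & V2 & V3). destruct (HT (w x) Hw) as (W1 & W2).
    assert (Hd : d x ^ 2 = 1 - c x ^ 2) by (unfold d; apply pow2_sqrt; nra).
    assert (N1 : Cmod (pm x) = 1).
    { apply Cmod_unique; [lra|]; unfold pm; cbn [fst snd]; nra. }
    assert (N2 : Cmod (pk x) = 1).
    { apply Cmod_unique; [lra|]; unfold pk; cbn [fst snd].
      rewrite Rpow_mult_distr, Hk2; lra. }
    splits.
    + intros i Hi. destruct (IP i Hi) as [Hi'|Hi'].
      * destruct (PP i x Hi') as [-> ->].
        rewrite !Cmod_mult, Cmod_conj, N1, N2, V1 by auto. lra.
      * destruct (PR i x Hi') as [-> ->]. split; auto.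
    + rewrite csum_app.
      rewrite (csum_ext rest _ (fun i => T i (w x))), W2 by (intros; apply PR; auto).
      rewrite (csum_ext P _ (fun i => pm x * s i (r x))%C), csum_mult, V2.
      2:{ intros i Hi; destruct (PP i x Hi) as [-> _]; ring. }
      apply Cmod_unique; [auto|].
      unfold pm, RtoC, Cmult, Cplus; cbn [fst snd]. rewrite E.
      transitivity (w x ^ 2 + 2 * r x * w x * c x + r x ^ 2 * (c x ^ 2 + d x ^ 2)); [ring|].
      rewrite Hd; ring.
    + rewrite csum_app.
      rewrite (csum_ext rest _ (fun i => T i (w x))), W2 by (intros; apply PR; auto).
      rewrite (csum_ext P _ (fun i => pk x * Cconj (s i (r x)))%C), csum_mult,
        csum_conj, V2.
      2:{ intros i Hi; destruct (PP i x Hi) as [_ ->]; ring. }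
      apply Cmod_unique; [auto|].
      unfold pk, RtoC, Cmult, Cplus, Cconj; cbn [fst snd]. rewrite E.
      transitivity (w x ^ 2 + 2 * r x * w x * c x + r x ^ 2 * (c x ^ 2 + k ^ 2 * d x ^ 2));
        [ring|]. rewrite Hd, Hk2; ring.
    + destruct (PP a x Pa) as [-> _], (PP b x Pb) as [-> _].
      rewrite !(Cmult_comm _ (pm x)), cross_rot; auto.
    + destruct (PP a x Pa) as [_ ->], (PP b x Pb) as [_ ->].
      rewrite !(Cmult_comm _ (pk x)), cross_rot, cross_conj; auto; lra.
  - intros i Hi. destruct (IP i Hi) as [Hi'|Hi']; [|destruct (PR i x0 Hi') as [-> ->]; auto].
    destruct (PP i x0 Hi') as [-> ->].
    (* For [k = 1] both the edge [s i (r x0)] and the direction [pm x0] are imaginary, so their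
       product is real and fixed by conjugation. *)
    assert (D : k = -1 /\ snd (s i (r x0)) = 0 \/ k = 1 /\ c x0 = 0 /\ fst (s i (r x0)) = 0).
    { destruct Hi' as [<-|[<-|[]]]; tauto. }
    unfold pm, pk. destruct (s i (r x0)) as [p q]; cbn [fst snd] in D.
    unfold Cmult, Cconj; cbn [fst snd].
    destruct D as [[-> ->]|(-> & -> & ->)]; f_equal; ring.
Qed.

(** An extreme total forces a flat triangle, and [0 < r] puts its line on the real axis. *)
Lemma pair_real (l : nat -> R) a b r u : 0 < l b <= l a -> 0 < r ->
  r = l a + l b \/ r = l a - l b -> valid l (b :: a :: nil) a b (RtoC r) u ->
  snd (u a) = 0 /\ snd (u b) = 0.
Proof.
  intros Hl Hr E (V1 & V2 & _). simpl in V2.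
  assert (Ha : Cmod (u a) ^ 2 = l a ^ 2) by (rewrite V1; simpl; auto).
  assert (Hb : Cmod (u b) ^ 2 = l b ^ 2) by (rewrite V1; simpl; auto).
  rewrite Cmod_sqr in Ha, Hb.
  destruct (u a) as [p q], (u b) as [p' q'].
  unfold Cplus, RtoC in V2; cbn [fst snd] in *. injection V2 as E1 E2.
  assert (p' = r - p) by lra. assert (q' = - q) by lra. subst p' q'.
  assert (P : 2 * r * p = 2 * r * l a) by (destruct E as [E|E]; nra).
  assert (p = l a) by nra. subst p. assert (q ^ 2 = 0) by lra. nra.
Qed.

(* [r] is kept equal to [rs] as long as the reach of the other edges allows it. *)
Lemma crossing_aligned (l : nat -> R) rest a b m (T s : nat -> R -> C) (rs x0 : R) :
  0 < l b <= l a -> (forall i, In i rest -> 0 < l i <= l b) ->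
  NoDup (rest ++ b :: a :: nil) ->
  0 <= m <= rsum rest l -> m <= l b ->
  (forall i, In i rest -> ccont (T i)) ->
  (forall w, m <= w <= rsum rest l ->
      (forall i, In i rest -> Cmod (T i w) = l i) /\ csum rest (fun i => T i w) = RtoC w) ->
  section l (b :: a :: nil) a b (l a - l b) (l a + l b) s ->
  0 < rsum rest l -> 0 < rs -> rs = l a + l b \/ rs = l a - l b ->
  0 <= x0 -> x0 <= rs + rsum rest l -> rs <= x0 + rsum rest l -> m <= x0 + rs ->
  crossing l (rest ++ b :: a :: nil) a b
    (Rmax 0 (l a - l b - rsum rest l)) (l a + l b + rsum rest l) x0.
Proof.
  intros Hab Hl Hnd Hm Hmb CT HT Hs HS Hrs Ers Hx0 B1 B2 B3.
  set (S := rsum rest l) in *.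
  (* A triangle with sides [x], [r] and a third side between [m] and [S] exists when
     [x - S <= r <= x + S] and [m - x <= r]; [r] is [rs] cut off by these bounds. Then [w] is the
     largest possible third side and [c] solves the law of cosines. Writing [Rmax 0 x] for [x] keeps
     [r] and [w] positive on the whole line. *)
  pose (r := fun x => Rmin (Rmax rs (Rmax (Rmax 0 x - S) (m - Rmax 0 x))) (Rmax 0 x + S)).
  pose (w := fun x => Rmin S (Rmax 0 x + r x)).
  pose (c := fun x => (Rmax 0 x ^ 2 - r x ^ 2 - w x ^ 2) / (2 * r x * w x)).
  assert (Hr0 : forall x, 0 < r x).
  { intros x; unfold r; pose proof (Rmax_l 0 x).
    pose proof (Rmax_l rs (Rmax (Rmax 0 x - S) (m - Rmax 0 x))). apply Rmin_glb_lt; lra. }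
  assert (Hw0 : forall x, 0 < w x).
  { intros x; unfold w; pose proof (Rmax_l 0 x). specialize (Hr0 x). apply Rmin_glb_lt; lra. }
  assert (Cr : continuity r) by (unfold r; auto 10 with cont).
  assert (Cw : continuity w) by (unfold w; auto with cont).
  assert (Er0 : r x0 = rs).
  { unfold r. rewrite (Rmax_right 0 x0) by lra. rewrite Rmax_left by (apply Rmax_lub; lra).
    apply Rmin_left; lra. }
  apply (crossing_of_triangle l rest a b _ _ m T s r w c (-1) x0); auto.
  - unfold c; apply continuity_divide; auto 8 with cont.
    intros x; specialize (Hr0 x); specialize (Hw0 x); nra.
  - fold S. intros x Hx. assert (Hx1 : 0 <= x) by (pose proof (Rmax_l 0 (l a - l b - S)); lra).
    assert (Hx2 : l a - l b - S <= x) by (pose proof (Rmax_r 0 (l a - l b - S)); lra).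
    specialize (Hr0 x); specialize (Hw0 x). unfold c.
    assert (Hr : l a - l b <= r x <= l a + l b /\ x - S <= r x <= x + S /\ m - x <= r x \/
                 l a - l b <= r x <= l a + l b /\ r x = x + S).
    { unfold r; rewrite (Rmax_right 0 x) by lra.
      set (A := Rmax rs (Rmax (x - S) (m - x))).
      assert (HA1 : rs <= A) by apply Rmax_l.
      assert (HA2 : x - S <= A) by (eapply Rle_trans; [apply Rmax_l|apply Rmax_r]).
      assert (HA3 : m - x <= A) by (eapply Rle_trans; [apply Rmax_r|apply Rmax_r]).
      assert (HA4 : A <= l a + l b) by (repeat apply Rmax_lub; lra).
      clearbody A. unfold Rmin; destruct (Rle_dec A (x + S)); lra. }
    assert (Hw : m <= w x <= S /\ w x <= x + r x /\ (w x = S \/ w x = x + r x)).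
    { unfold w; rewrite (Rmax_right 0 x) by lra. unfold Rmin.
      destruct (Rle_dec S (x + r x)); lra. }
    rewrite (Rmax_right 0 x) by lra.
    clearbody r w. set (R1 := r x) in *. set (W := w x) in *. clearbody R1 W.
    assert (Tr : x <= R1 + W /\ W <= x + R1 /\ R1 <= x + W) by lra.
    set (q := (x ^ 2 - R1 ^ 2 - W ^ 2) / (2 * R1 * W)).
    assert (Eq : 2 * R1 * W * q = x ^ 2 - R1 ^ 2 - W ^ 2) by (unfold q; field; lra).
    clearbody q. splits; try lra.
    + assert (0 < R1 * W) by nra. assert (0 <= x ^ 2 - (R1 - W) ^ 2) by nra. nra.
    + assert (0 < R1 * W) by nra. assert (0 <= (R1 + W) ^ 2 - x ^ 2) by nra. nra.
  - left; split; auto. rewrite Er0.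
    apply (pair_real l a b rs (fun i => s i rs)); auto. apply Hs; lra.
Qed.

(* At [x0] the pair is folded onto itself.  It is opened at a right angle to the other edges
   when [x] increases from [x0], and to the total vector when [x] decreases, so that its
   direction has a limit at [x0]. *)
Lemma crossing_folded (l : nat -> R) rest a b m (T s : nat -> R -> C) (x0 : R) :
  0 < l b -> l a = l b -> NoDup (rest ++ b :: a :: nil) ->
  0 <= m <= rsum rest l -> m <= l b ->
  (forall i, In i rest -> ccont (T i)) ->
  (forall w, m <= w <= rsum rest l ->
      (forall i, In i rest -> Cmod (T i w) = l i) /\ csum rest (fun i => T i w) = RtoC w) ->
  section l (b :: a :: nil) a b (l a - l b) (l a + l b) s ->
  fst (s a 0) = 0 -> fst (s b 0) = 0 ->
  m <= x0 <= rsum rest l -> x0 + rsum rest l < l a + l b ->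
  crossing l (rest ++ b :: a :: nil) a b
    (Rmax 0 (l a - l b - rsum rest l)) (l a + l b + rsum rest l) x0.
Proof.
  intros Hb Hab Hnd Hm Hmb CT HT Hs Fa Fb Hx0 B.
  set (S := rsum rest l) in *. set (d := l a + l b) in *.
  assert (Hd : 0 < d) by (unfold d; lra).
  replace (Rmax 0 (l a - l b - S)) with 0 by (rewrite Rmax_left; lra).
  destruct (Req_dec x0 0) as [E0|E0].
  (* While [x <= d] the other edges sum to zero and [c] has no effect on the length. It moves from
     0, required at [x0], to 1, required as soon as [w] is positive. *)
  - pose (r := fun x => Rmin d x). pose (w := fun x => Rmax 0 (x - d)).
    pose (c := fun x => clamp 0 1 (x * / d)).
    apply (crossing_of_triangle l rest a b _ _ m T s r w c 1 x0); auto;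
      try (unfold r, w, c; auto 8 using continuity_clamp with cont).
    + fold S; fold d. intros x Hx. pose proof (clamp_bounds 0 1 (x * / d) Rle_0_1).
      unfold r, w, c. destruct (Rle_lt_dec x d) as [Q|Q].
      * rewrite Rmin_right, Rmax_left by lra. splits; try lra; try ring.
      * rewrite Rmin_left, Rmax_right by lra. rewrite clamp_high; splits; try lra; try ring.
        apply Rmult_le_reg_r with d; [auto|]. rewrite Rmult_assoc, Rinv_l; lra.
    + right. rewrite E0. unfold r, c. rewrite Rmult_0_l, Rmin_right by lra.
      splits; auto. apply clamp_id; lra.
  - assert (Hx00 : 0 < x0) by lra.
    (* By Pythagoras [q x] is the missing leg. Below [x0] the hypotenuse is [w = x0] and
       [c = - q x / x0]; above, it is [x] and [c = 0] until [q x] reaches [d]. From there on [r = d]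
       and the law of cosines determines [c]. At most one of the two terms of [c] is nonzero. *)
    pose (q := fun x => sqrt (Rabs (x ^ 2 - x0 ^ 2))).
    pose (r := fun x => Rmin d (q x)). pose (w := fun x => Rmax x0 (x - d)).
    pose (c := fun x => - sqrt (Rmax 0 (x0 ^ 2 - x ^ 2)) * / x0 +
       Rmax 0 ((x ^ 2 - d ^ 2 - w x ^ 2) / (2 * d * w x))).
    assert (Hw0 : forall x, 0 < w x) by (intros x; unfold w; pose proof (Rmax_l x0 (x - d)); lra).
    assert (Cw : continuity w) by (unfold w; auto with cont).
    assert (Cr : continuity r) by (unfold r, q; auto 8 with cont).
    assert (Cc : continuity c).
    { unfold c. apply continuity_add; [auto 8 with cont|].
      apply continuity_max; [auto with cont|]. apply continuity_divide; auto 8 with cont.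
      intros x; specialize (Hw0 x); nra. }
    assert (Q2 : forall x, 0 <= q x /\ q x ^ 2 = Rabs (x ^ 2 - x0 ^ 2)).
    { intros x; split; [apply sqrt_pos|apply pow2_sqrt, Rabs_pos]. }
    apply (crossing_of_triangle l rest a b _ _ m T s r w c 1 x0); auto.
    + fold S; fold d. intros x Hx. specialize (Hw0 x). destruct (Q2 x) as [Qp Q3].
      replace (l a - l b) with 0 by lra.
      destruct (Rle_lt_dec x x0) as [H|H].
      * assert (Hw : w x = x0) by (unfold w; apply Rmax_left; lra).
        assert (Ec : c x = - q x * / x0).
        { unfold c, q. rewrite Hw.
          rewrite Rabs_left1 by nra. rewrite (Rmax_right 0) by nra.
          rewrite (Rmax_left 0).
          - replace (- (x ^ 2 - x0 ^ 2)) with (x0 ^ 2 - x ^ 2) by ring. ring.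
          - assert (0 < / (2 * d * x0)) by (apply Rinv_0_lt_compat; nra).
            unfold Rdiv. assert (x ^ 2 - d ^ 2 - x0 ^ 2 <= 0) by nra. nra. }
        rewrite Rabs_left1 in Q3 by nra.
        assert (Qx : q x <= x0) by (apply Rsqr_le_inv; nra).
        assert (Er : r x = q x) by (unfold r; apply Rmin_right; lra).
        rewrite Er, Hw, Ec.
        assert (Eq : 0 <= q x * / x0 <= 1).
        { split; [apply Rmult_le_pos; [auto|left; apply Rinv_0_lt_compat; auto]|].
          apply Rmult_le_reg_r with x0; [auto|]. rewrite Rmult_assoc, Rinv_l; lra. }
        splits; try lra.
        replace (2 * q x * x0 * (- q x * / x0)) with (- 2 * q x ^ 2) by (field; lra). lra.
      * rewrite Rabs_pos_eq in Q3 by nra.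
        assert (Hfirst : sqrt (Rmax 0 (x0 ^ 2 - x ^ 2)) = 0).
        { rewrite Rmax_left by nra; apply sqrt_0. }
        assert (Hp : 0 < 2 * d * w x) by nra.
        set (g := (x ^ 2 - d ^ 2 - w x ^ 2) / (2 * d * w x)).
        assert (Eg : 2 * d * w x * g = x ^ 2 - d ^ 2 - w x ^ 2) by (unfold g; field; lra).
        assert (Ec : c x = Rmax 0 g) by (unfold c; rewrite Hfirst; fold g; ring).
        clearbody g. rewrite Ec.
        destruct (Rle_lt_dec (q x) d) as [Hq|Hq].
        -- assert (Er : r x = q x) by (unfold r; apply Rmin_right; lra).
           assert (Hqd : (x - x0) * (x + x0) <= d ^ 2) by nra.
           assert (Hw : w x = x0) by (unfold w; apply Rmax_left; nra).
           rewrite Hw in *. rewrite Rmax_left by nra. rewrite Er. splits; lra.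
        -- assert (Er : r x = d) by (unfold r; apply Rmin_left; lra).
           assert (Hqd : d ^ 2 < x ^ 2 - x0 ^ 2) by nra.
           assert (Hw : x - d <= w x <= S /\ x0 <= w x /\ (w x = x0 \/ w x = x - d)).
           { unfold w, Rmax; destruct (Rle_dec x0 (x - d)); lra. }
           destruct Hw as (Hw1 & Hw2 & Hw3).
           assert (Hg : 0 <= g) by (destruct Hw3 as [Hw3|Hw3]; rewrite Hw3 in *; nra).
           rewrite Rmax_right by auto. rewrite Er. clearbody w. splits; try lra; nra.
    + right. assert (Eq : q x0 = 0).
      { unfold q. rewrite Rminus_diag, Rabs_R0; apply sqrt_0. }
      assert (Er : r x0 = 0) by (unfold r; rewrite Eq; apply Rmin_right; lra).
      rewrite Er; splits; auto.
      unfold c. rewrite (Rmax_left 0 (x0 ^ 2 - x0 ^ 2)) by lra. rewrite sqrt_0, Rmax_left; [ring|].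
      replace (w x0) with x0 by (unfold w; rewrite Rmax_left; lra).
      assert (Hi : 0 < / (2 * d * x0)) by (apply Rinv_0_lt_compat; nra).
      replace (x0 ^ 2 - d ^ 2 - x0 ^ 2) with (- d ^ 2) by ring.
      unfold Rdiv; pose proof (pow2_ge_0 d); nra.
Qed.

(** Parallel edges are stretched or folded, so their total [rs] is [l a + l b] or [l a - l b]. The
    delicate case is [rs = 0], where the pair has no direction. *)
Lemma crossing_exists (l : nat -> R) rest a b u :
  0 < l b <= l a -> (forall i, In i rest -> 0 < l i <= l b) ->
  NoDup (rest ++ b :: a :: nil) ->
  (forall i, In i (rest ++ b :: a :: nil) -> Cmod (u i) = l i) ->
  cross (u a) (u b) = 0 ->
  crossing l (rest ++ b :: a :: nil) a b
    (Rmax 0 (l a - l b - rsum rest l)) (l a + l b + rsum rest l)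
    (Cmod (csum (rest ++ b :: a :: nil) u)).
Proof.
  intros Hab Hl Hnd Hu Hcr.
  assert (Hne : a <> b).
  { intros ->. apply NoDup_app_remove_l in Hnd. inversion Hnd as [|? ? Hin]; subst.
    apply Hin; simpl; auto. }
  destruct (section_pair l a b Hne Hab) as (s & Hs & Hs0).
  destruct (rest_section l rest) as (m & T & Hm & HmB & Hmu & CT & HT).
  { intros i Hi; apply Hl; auto. }
  { eapply NoDup_app_remove_r; eassumption. }
  assert (Hmb : m <= l b) by (apply HmB; [lra|]; intros; apply Hl; auto).
  assert (Ha : Cmod (u a) = l a) by (apply Hu, in_or_app; simpl; auto).
  assert (Hb : Cmod (u b) = l b) by (apply Hu, in_or_app; simpl; auto).
  assert (Hur : forall i, In i rest -> Cmod (u i) = l i) by (intros; apply Hu, in_or_app; auto).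
  pose proof (Cmod_csum_le _ _ _ Hur) as HWS. specialize (Hmu u Hur).
  set (x0 := Cmod (csum (rest ++ b :: a :: nil) u)).
  assert (E : (csum rest u + (u a + u b))%C = csum (rest ++ b :: a :: nil) u).
  { rewrite csum_app; simpl; ring. }
  pose proof (Cmod_sum_le _ _ _ E) as T1. pose proof (Cmod_diff_le _ _ _ E) as T2.
  rewrite Cplus_comm in E. pose proof (Cmod_diff_le _ _ _ E) as T3. fold x0 in T1, T2, T3.
  assert (Hx0 : 0 <= x0) by apply Cmod_ge_0.
  assert (Hrs : Cmod (u a + u b)%C = l a + l b \/ Cmod (u a + u b)%C = l a - l b).
  { pose proof (Cmod_sqr (u a)) as A. pose proof (Cmod_sqr (u b)) as B.
    rewrite Ha in A; rewrite Hb in B.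
    unfold cross in Hcr. destruct (u a) as [p q], (u b) as [p' q']. cbn [fst snd] in *.
    assert (D : (p * p' + q * q') ^ 2 = (l a * l b) ^ 2).
    { rewrite Rpow_mult_distr, A, B.
      transitivity ((p ^ 2 + q ^ 2) * (p' ^ 2 + q' ^ 2) - (p * q' - q * p') ^ 2); [ring|].
      rewrite Hcr; ring. }
    assert (D' : p * p' + q * q' = l a * l b \/ p * p' + q * q' = - (l a * l b)).
    { assert (Z : (p * p' + q * q' - l a * l b) * (p * p' + q * q' + l a * l b) = 0) by nra.
      apply Rmult_integral in Z; lra. }
    destruct D'; [left|right]; apply Cmod_unique; try lra;
      unfold Cplus; cbn [fst snd]; nra. }
  set (rs := Cmod (u a + u b)%C) in *.
  destruct (list_eq_dec Nat.eq_dec rest nil) as [Er|Er].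
  - subst rest. simpl rsum in *. simpl csum in *. rewrite Cmod_0 in *.
    assert (Exr : x0 = rs) by lra.
    rewrite Rminus_0_r, Rplus_0_r.
    destruct (Req_dec rs 0) as [E0|E0].
    + apply (crossing_of_triangle l nil a b _ _ m T s (fun x => x) (fun _ => 0) (fun _ => 0) 1 x0);
        auto with cont.
      * simpl; intros x Hx. rewrite Rmax_right in Hx by lra. splits; try lra; ring.
      * right; rewrite Exr, E0; splits; auto; apply Hs0; lra.
    + apply (crossing_of_triangle l nil a b _ _ m T s (fun x => x) (fun _ => 0) (fun _ => 0)
        (-1) x0);
        auto with cont.
      * simpl; intros x Hx. rewrite Rmax_right in Hx by lra. splits; try lra; ring.
      * left; split; auto. rewrite Exr.
        apply (pair_real l a b rs (fun i => s i rs)); auto; [lra|]. apply Hs; lra.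
  - assert (HS : 0 < rsum rest l).
    { destruct rest as [|i rest]; [congruence|]. simpl.
      pose proof (Hl i (or_introl eq_refl)).
      assert (0 <= rsum rest l) by (apply rsum_nonneg; intros; apply Hl; simpl; auto). lra. }
    destruct (Req_dec rs 0) as [E0|E0].
    + assert (Eab : l a = l b) by lra.
      (* If the other edges are long enough, the fiber over [x0] also contains a placement with the
         pair stretched, and that one is used instead. *)
      destruct (Rle_lt_dec (l a + l b) (x0 + rsum rest l)) as [Q|Q].
      * apply (crossing_aligned l rest a b m T s (l a + l b)); auto; lra.
      * apply (crossing_folded l rest a b m T s); auto; try lra; apply Hs0; auto.
    + assert (0 <= rs) by apply Cmod_ge_0.
      apply (crossing_aligned l rest a b m T s rs); auto; lra.
Qed.

(** * Lifting at the level of edge vectors *)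

(** The sign of [cross (u a) (u b)] decides between [sp] and [sm]; in the negative half everything
    is conjugated before [half_fiber_joined] applies. Either choice gives [s i x0 = sp i x0], so the
    sections selected for two different placements still meet at [x0]. *)
Lemma join_to_section (l : nat -> R) rest a b lo hi x0 x (sp sm : nat -> R -> C) u :
  0 < l b <= l a -> (forall i, In i rest -> 0 < l i <= l b) ->
  NoDup (rest ++ b :: a :: nil) ->
  (forall i, In i (rest ++ b :: a :: nil) -> ccont (sp i) /\ ccont (sm i)) ->
  (forall x, lo <= x <= hi ->
     (forall i, In i (rest ++ b :: a :: nil) -> Cmod (sp i x) = l i /\ Cmod (sm i x) = l i) /\
     Cmod (csum (rest ++ b :: a :: nil) (fun i => sp i x)) = x /\
     Cmod (csum (rest ++ b :: a :: nil) (fun i => sm i x)) = x /\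
     0 <= cross (sp a x) (sp b x) /\ cross (sm a x) (sm b x) <= 0) ->
  (forall i, In i (rest ++ b :: a :: nil) -> sp i x0 = sm i x0) ->
  (forall i, In i (rest ++ b :: a :: nil) -> Cmod (u i) = l i) ->
  Cmod (csum (rest ++ b :: a :: nil) u) = x -> lo <= x <= hi ->
  exists (s g : nat -> R -> C) (e : C), Cmod e = 1 /\
    (forall i, In i (rest ++ b :: a :: nil) -> ccont (s i) /\ ccont (g i) /\
       s i x0 = sp i x0 /\ g i 0 = (e * u i)%C /\ g i 1 = s i x) /\
    (forall y, lo <= y <= hi ->
      (forall i, In i (rest ++ b :: a :: nil) -> Cmod (s i y) = l i) /\
      Cmod (csum (rest ++ b :: a :: nil) (fun i => s i y)) = y) /\
    (forall t, (forall i, In i (rest ++ b :: a :: nil) -> Cmod (g i t) = l i) /\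
      Cmod (csum (rest ++ b :: a :: nil) (fun i => g i t)) = x).
Proof.
  intros Hab Hl Hnd. pose proof (half_fiber_joined l rest a b Hab Hl Hnd) as K. clear Hl Hnd.
  assert (Ha : In a (rest ++ b :: a :: nil)) by (apply in_or_app; simpl; auto).
  assert (Hb : In b (rest ++ b :: a :: nil)) by (apply in_or_app; simpl; auto).
  set (L := rest ++ b :: a :: nil) in *. clearbody L.
  intros Cs Hs H0 Hu Hx Hr. destruct (Hs x Hr) as (S1 & S2 & S3 & S4 & S5).
  destruct (Rle_lt_dec 0 (cross (u a) (u b))) as [Hc|Hc].
  - destruct (same_Cmod_rot (csum L u) (csum L (fun i => sp i x))) as (e & He & Ee);
      [congruence|].
    destruct (K (csum L (fun i => sp i x)) (fun i => e * u i)%C (fun i => sp i x))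
      as (g & G1 & G2 & G3).
    { rewrite Ee. apply valid_rot; auto. split; auto. }
    { split; [|split]; auto. intros i Hi; now apply S1. }
    exists sp, g, e; splits; auto.
    + intros i Hi; destruct (G3 i Hi); splits; auto; now apply Cs.
    + intros y Hy; destruct (Hs y Hy) as (Q1 & Q2 & _); split; auto.
      intros i Hi; now apply Q1.
    + intros t; destruct (G2 t) as (Q1 & Q2 & _); split; auto. now rewrite Q2.
  - destruct (same_Cmod_rot (csum L u) (csum L (fun i => sm i x))) as (e & He & Ee);
      [congruence|].
    destruct (K (Cconj (csum L (fun i => sm i x))) (fun i => Cconj (e * u i)%C)
      (fun i => Cconj (sm i x))) as (g & G1 & G2 & G3).
    { split; [|split].
      - intros i Hi; rewrite Cmod_conj, Cmod_mult, He, Hu; auto; ring.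
      - now rewrite csum_conj, csum_mult, Ee.
      - rewrite cross_conj, cross_rot; auto; lra. }
    { split; [|split].
      - intros i Hi; rewrite Cmod_conj; now apply S1.
      - now rewrite csum_conj.
      - rewrite cross_conj; lra. }
    exists sm, (fun i t => Cconj (g i t)), e; splits; auto.
    + intros i Hi; destruct (G3 i Hi) as [-> ->]; rewrite !Cconj_conj; splits; auto.
      * now apply Cs.
      * apply ccont_conj; auto.
      * symmetry; auto.
    + intros y Hy; destruct (Hs y Hy) as (Q1 & _ & Q2 & _); split; auto.
      intros i Hi; now apply Q1.
    + intros t; destruct (G2 t) as (Q1 & Q2 & _); split.
      * intros i Hi; rewrite Cmod_conj; auto.
      * now rewrite csum_conj, Q2, !Cmod_conj.
Qed.

Lemma lift_edges (l : nat -> R) rest a b (u v : nat -> C) (al : R -> R) (eps del ts : R) :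
  0 < l b <= l a -> (forall i, In i rest -> 0 < l i <= l b) ->
  NoDup (rest ++ b :: a :: nil) ->
  (forall i, In i (rest ++ b :: a :: nil) -> Cmod (u i) = l i) ->
  (forall i, In i (rest ++ b :: a :: nil) -> Cmod (v i) = l i) ->
  continuity al ->
  (forall t, Rmax 0 (l a - l b - rsum rest l) <= al t <= l a + l b + rsum rest l) ->
  0 < eps -> 0 < del -> eps <= ts <= 1 - del ->
  (forall t, 0 <= t <= eps -> al t = Cmod (csum (rest ++ b :: a :: nil) u)) ->
  (forall t, 1 - del <= t <= 1 -> al t = Cmod (csum (rest ++ b :: a :: nil) v)) ->
  crossing l (rest ++ b :: a :: nil) a b (Rmax 0 (l a - l b - rsum rest l))
    (l a + l b + rsum rest l) (al ts) ->
  exists (F : nat -> R -> C) (e f : C), Cmod e = 1 /\ Cmod f = 1 /\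
    (forall i, In i (rest ++ b :: a :: nil) ->
       ccont (F i) /\ F i 0 = (e * u i)%C /\ F i 1 = (f * v i)%C) /\
    forall t, 0 <= t <= 1 ->
      (forall i, In i (rest ++ b :: a :: nil) -> Cmod (F i t) = l i) /\
      Cmod (csum (rest ++ b :: a :: nil) (fun i => F i t)) = al t.
Proof.
  intros Hab Hl Hnd Hu Hv Ca Har He Hd Hts Hau Hav (sp & sm & X1 & X2 & X3).
  set (lo := Rmax 0 (l a - l b - rsum rest l)) in *.
  set (hi := l a + l b + rsum rest l) in *.
  assert (Eu : al eps = Cmod (csum (rest ++ b :: a :: nil) u)) by (apply Hau; lra).
  assert (Ev : al (1 - del) = Cmod (csum (rest ++ b :: a :: nil) v)) by (apply Hav; lra).
  destruct (join_to_section l rest a b lo hi (al ts) (al eps) sp sm u)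
    as (s & g & e & He1 & A1 & A2 & A3); auto.
  destruct (join_to_section l rest a b lo hi (al ts) (al (1 - del)) sp sm v)
    as (s' & g' & f & Hf1 & B1 & B2 & B3); auto.
  set (L := rest ++ b :: a :: nil) in *.
  (* A telescoping sum of four moves, each frozen outside its own time interval. The second and
     third match since [s] and [s'] agree over [al ts]; the last runs [g'] backwards, from the
     section to [v] up to rotation. *)
  pose (F := fun i t => (g i (clamp 0 1 (t * / eps)%R)
    + (s i (al (clamp eps ts t)) - s i (al eps))
    + (s' i (al (clamp ts (1 - del)%R t)) - s' i (al ts))
    + (g' i (clamp 0 1 ((1 - t) * / del)%R) - s' i (al (1 - del)%R)))%C).
  assert (He' : 0 < / eps) by now apply Rinv_0_lt_compat.
  assert (Hd' : 0 < / del) by now apply Rinv_0_lt_compat.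
  assert (Heps : forall t, t <= eps -> t * / eps <= 1).
  { intros t Ht. apply Rmult_le_reg_r with eps; auto. rewrite Rmult_assoc, Rinv_l; lra. }
  assert (Heps' : forall t, eps <= t -> 1 <= t * / eps).
  { intros t Ht. apply Rmult_le_reg_r with eps; auto. rewrite Rmult_assoc, Rinv_l; lra. }
  assert (Hdel : forall t, 1 - del <= t -> (1 - t) * / del <= 1).
  { intros t Ht. apply Rmult_le_reg_r with del; auto. rewrite Rmult_assoc, Rinv_l; lra. }
  assert (Hdel' : forall t, t <= 1 - del -> 1 <= (1 - t) * / del).
  { intros t Ht. apply Rmult_le_reg_r with del; auto. rewrite Rmult_assoc, Rinv_l; lra. }
  assert (F1 : forall i t, In i L -> 0 <= t <= eps -> F i t = g i (t * / eps)).
  { intros i t Hi Ht. destruct (B1 i Hi) as (_ & _ & _ & _ & Q).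
    unfold F. rewrite (clamp_low eps), (clamp_low ts), (clamp_high 0 1 ((1 - t) * / del)), Q
      by (try apply Hdel'; lra).
    rewrite clamp_id; [ring|]. split; [apply Rmult_le_pos; lra|apply Heps; lra]. }
  assert (F2 : forall i t, In i L -> eps <= t <= ts -> F i t = s i (al t)).
  { intros i t Hi Ht. destruct (B1 i Hi) as (_ & _ & _ & _ & Q).
    destruct (A1 i Hi) as (_ & _ & _ & _ & Q').
    unfold F. rewrite (clamp_id eps), (clamp_low ts), (clamp_high 0 1 ((1 - t) * / del)), Q,
      (clamp_high 0 1), Q' by (try apply Hdel'; try apply Heps'; lra). ring. }
  assert (F3 : forall i t, In i L -> ts <= t <= 1 - del -> F i t = s' i (al t)).
  { intros i t Hi Ht. destruct (B1 i Hi) as (_ & _ & Q2 & _ & Q).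
    destruct (A1 i Hi) as (_ & _ & Q3 & _ & Q').
    unfold F. rewrite (clamp_high eps), (clamp_id ts), (clamp_high 0 1 ((1 - t) * / del)), Q,
      (clamp_high 0 1), Q', Q2, Q3 by (try apply Hdel'; try apply Heps'; lra). ring. }
  assert (F4 : forall i t, In i L -> 1 - del <= t <= 1 -> F i t = g' i ((1 - t) * / del)).
  { intros i t Hi Ht. destruct (B1 i Hi) as (_ & _ & Q2 & _ & Q).
    destruct (A1 i Hi) as (_ & _ & Q3 & _ & Q').
    unfold F. rewrite (clamp_high eps), (clamp_high ts), (clamp_high 0 1 (t * / eps)), Q', Q2, Q3
      by (try apply Heps'; lra).
    rewrite clamp_id; [ring|]. split; [apply Rmult_le_pos; lra|apply Hdel; lra]. }
  exists F, e, f; splits; auto.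
  - intros i Hi. destruct (A1 i Hi) as (Q1 & Q2 & Q3 & Q4 & Q5).
    destruct (B1 i Hi) as (P1 & P2 & P3 & P4 & P5). splits.
    + assert (ccont (fun t => g i (clamp 0 1 (t * / eps)))).
      { apply ccont_comp with (g := fun t => clamp 0 1 (t * / eps)); auto with cont. }
      assert (ccont (fun t => g' i (clamp 0 1 ((1 - t) * / del)))).
      { apply ccont_comp with (g := fun t => clamp 0 1 ((1 - t) * / del)); auto with cont. }
      assert (ccont (fun t => s i (al (clamp eps ts t)))).
      { apply ccont_comp with (g := fun t => al (clamp eps ts t)); auto.
        apply continuity_compose with (g := fun t => clamp eps ts t); auto with cont. }
      assert (ccont (fun t => s' i (al (clamp ts (1 - del) t)))).
      { apply ccont_comp with (g := fun t => al (clamp ts (1 - del) t)); auto.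
        apply continuity_compose with (g := fun t => clamp ts (1 - del) t); auto with cont. }
      unfold F; auto 8 with cont.
    + rewrite F1, Rmult_0_l; auto; lra.
    + rewrite F4, Rminus_diag, Rmult_0_l; auto; lra.
  - intros t Ht.
    destruct (Rle_lt_dec t eps) as [H1|H1]; [|destruct (Rle_lt_dec t ts) as [H2|H2];
      [|destruct (Rle_lt_dec t (1 - del)) as [H3|H3]]].
    + rewrite (csum_ext L _ (fun i => g i (t * / eps))) by (intros; apply F1; auto; lra).
      destruct (A3 (t * / eps)) as [Q1 Q2]; rewrite Q2, (Hau t), Eu by lra.
      split; auto. intros i Hi; rewrite F1 by (auto; lra); auto.
    + rewrite (csum_ext L _ (fun i => s i (al t))) by (intros; apply F2; auto; lra).
      destruct (A2 (al t)) as [Q1 Q2]; auto.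
      split; auto. intros i Hi; rewrite F2 by (auto; lra); auto.
    + rewrite (csum_ext L _ (fun i => s' i (al t))) by (intros; apply F3; auto; lra).
      destruct (B2 (al t)) as [Q1 Q2]; auto.
      split; auto. intros i Hi; rewrite F3 by (auto; lra); auto.
    + rewrite (csum_ext L _ (fun i => g' i ((1 - t) * / del))) by (intros; apply F4; auto; lra).
      destruct (B3 ((1 - t) * / del)) as [Q1 Q2]; rewrite Q2, (Hav t), Ev by lra.
      split; auto. intros i Hi; rewrite F4 by (auto; lra); auto.
Qed.

(** * From edge vectors back to placements and the topology of M(P) *)

Definition edge (p : config) (i : nat) : C := ((p (S i) : C) - (p i : C))%C.

Definition placement (u : nat -> C) : config := fun j => csum (List.seq 0 j) u.

Lemma edist_Cmod (u v : C) : edist u v = Cmod (v - u)%C.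
Proof. unfold edist, Cmod; f_equal; simpl; ring. Qed.

Lemma csum_seq_S (j : nat) (u : nat -> C) :
  csum (List.seq 0 (S j)) u = (csum (List.seq 0 j) u + u j)%C.
Proof. rewrite seq_S, csum_app; simpl; ring. Qed.

Lemma edge_placement (u : nat -> C) (i : nat) : edge (placement u) i = u i.
Proof. unfold edge, placement; rewrite csum_seq_S; ring. Qed.

Lemma placement_edge (p : config) (j : nat) :
  csum (List.seq 0 j) (edge p) = ((p j : C) - (p 0%nat : C))%C.
Proof.
  induction j as [|j IH]; [simpl; ring|]. rewrite csum_seq_S, IH; unfold edge; ring.
Qed.

Lemma inC_edge (k : nat) (l : nat -> R) (p : config) :
  inC k l p <-> forall i, (i < k)%nat -> Cmod (edge p i) = l i.
Proof.
  unfold inC, edge; split; intros H i Hi; rewrite <- (H i Hi), edist_Cmod; reflexivity.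
Qed.

Lemma theta_edge (k : nat) (p : config) :
  theta k p = Cmod (csum (List.seq 0 k) (edge p)).
Proof. unfold theta; now rewrite edist_Cmod, placement_edge. Qed.

Lemma congruent_edge (k : nat) (p q : config) : congruent k p q ->
  exists e : C, Cmod e = 1 /\ forall i, (i < k)%nat -> edge q i = (e * edge p i)%C.
Proof.
  intros (c & s & a & b & E & H). exists (c, s); split.
  - apply Cmod_unique; [lra|exact (eq_trans E (eq_sym (pow1 2)))].
  - intros i Hi. destruct (H i) as [H1 H2]; [lia|]. destruct (H (S i)) as [H3 H4]; [lia|].
    unfold edge, Cminus, Copp, Cplus, Cmult; cbn [fst snd]. rewrite H1, H2, H3, H4.
    f_equal; ring.
Qed.

(** Edges determine all vertices from the first one, so the translation is read off at vertex 0. *)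
Lemma congruent_of_edges (k : nat) (p q : config) (e : C) : Cmod e = 1 ->
  (forall i, (i < k)%nat -> edge q i = (e * edge p i)%C) -> congruent k p q.
Proof.
  intros He H.
  pose (t := ((q 0%nat : C) - e * (p 0%nat : C))%C).
  exists (fst e), (snd e), (fst t), (snd t); split.
  - rewrite <- Cmod_sqr, He; ring.
  - intros i Hi.
    assert (E : @eq C (q i) (e * (p i : C) + t)%C).
    { assert (G : forall x y z : C, z = (x - y)%C -> x = (z + y)%C) by (intros; subst; ring).
      rewrite (G _ _ _ (placement_edge q i)), (csum_ext _ _ (fun j => e * edge p j)%C)
        by (intros j Hj; apply in_seq in Hj; apply H; lia).
      rewrite csum_mult, placement_edge. unfold t; ring. }
    rewrite E; simpl; split; ring.
Qed.

Lemma edist_le_cdist (k i : nat) (p q : config) : (i <= k)%nat ->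
  edist (p i) (q i) <= cdist k p q.
Proof.
  assert (P : forall x y, 0 <= edist x y) by (intros; apply sqrt_pos).
  unfold cdist; induction k as [|k IH]; simpl; intros Hi.
  - replace i with 0%nat by lia; lra.
  - destruct (Nat.eq_dec i (S k)) as [->|Hn].
    + assert (0 <= sum_f_R0 (fun i => edist (p i) (q i)) k) by (apply cond_pos_sum; auto). lra.
    + specialize (P (p (S k)) (q (S k))). specialize (IH ltac:(lia)). lra.
Qed.

Lemma edge_diff_le (k i : nat) (p q : config) : (i < k)%nat ->
  Cmod (edge q i - edge p i)%C <= 2 * cdist k p q.
Proof.
  intros Hi.
  pose proof (edist_le_cdist k i p q ltac:(lia)) as H1.
  pose proof (edist_le_cdist k (S i) p q ltac:(lia)) as H2.
  rewrite edist_Cmod in H1, H2.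
  assert (E : ((q (S i) - p (S i)) + - (q i - p i) = edge q i - edge p i)%C)
    by (unfold edge; ring).
  pose proof (Cmod_sum_le _ _ _ E) as T. rewrite Cmod_opp in T.
  eapply Rle_trans; [exact T|]. lra.
Qed.

Lemma cross_bound (u v : C) : Rabs (cross u v) <= Cmod u * Cmod v.
Proof.
  replace (cross u v) with (Im (Cconj u * v)%C) by (unfold cross; simpl; ring).
  eapply Rle_trans; [|eapply Rle_trans; [apply Rmax_Cmod|]]; [apply Rmax_r|].
  rewrite Cmod_mult, Cmod_conj; lra.
Qed.

Lemma Mopen_cross (k : nat) (l : nat -> R) (i j : nat) (sg : R) :
  (i < k)%nat -> (j < k)%nat -> sg = 1 \/ sg = -1 ->
  Mopen k l (fun p => 0 < sg * cross (edge p i) (edge p j)).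
Proof.
  intros Hi Hj Hsg; split.
  - intros p q _ _ Hpq Hp. destruct (congruent_edge k p q Hpq) as (e & He & E).
    now rewrite !E, cross_rot by auto.
  - intros p Hp Hpos.
    set (c := sg * cross (edge p i) (edge p j)) in *.
    pose proof (Cmod_ge_0 (edge p i)) as A0. pose proof (Cmod_ge_0 (edge p j)) as B0.
    set (A := Cmod (edge p i)) in *. set (B := Cmod (edge p j)) in *.
    (* Each edge moves by at most [2 * d], so the cross product changes by at most
       [2 * d * A + 2 * d * B + 4 * d ^ 2], which is at most [d * D] when [d < 1]. *)
    set (D := 2 * A + 2 * B + 4).
    exists (Rmin 1 (c / D)). assert (HD : 0 < D) by (unfold D; lra).
    assert (Hc : 0 < c / D) by (apply Rdiv_lt_0_compat; auto).
    split; [apply Rmin_glb_lt; lra|].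
    intros q Hq Hd. set (d := cdist k p q) in *.
    assert (Hd1 : d < 1) by (eapply Rlt_le_trans; [exact Hd|apply Rmin_l]).
    assert (Hd2 : d * D < c).
    { apply Rmult_lt_reg_r with (/ D); [now apply Rinv_0_lt_compat|].
      rewrite Rmult_assoc, Rinv_r, Rmult_1_r by lra.
      eapply Rlt_le_trans; [exact Hd|apply Rmin_r]. }
    pose proof (edge_diff_le k i p q Hi) as Di. pose proof (edge_diff_le k j p q Hj) as Dj.
    fold d in Di, Dj.
    set (x := (edge q i - edge p i)%C) in *. set (y := (edge q j - edge p j)%C) in *.
    pose proof (Cmod_ge_0 x) as Hx. pose proof (Cmod_ge_0 y) as Hy.
    pose proof (cross_bound (edge p i) y) as K1. pose proof (cross_bound x (edge p j)) as K2.
    pose proof (cross_bound x y) as K3. fold A in K1. fold B in K2.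
    assert (E : cross (edge q i) (edge q j) = cross (edge p i) (edge p j)
       + (cross (edge p i) y + cross x (edge p j) + cross x y)).
    { unfold cross, x, y; simpl; ring. }
    rewrite E, Rmult_plus_distr_l. fold c.
    set (r := cross (edge p i) y + cross x (edge p j) + cross x y).
    assert (Hr : Rabs r < c).
    { unfold r. eapply Rle_lt_trans; [apply Rabs_triang|].
      eapply Rle_lt_trans; [apply Rplus_le_compat_r, Rabs_triang|].
      assert (A * Cmod y <= A * (2 * d)) by (apply Rmult_le_compat_l; auto).
      assert (Cmod x * B <= (2 * d) * B) by (apply Rmult_le_compat_r; auto).
      assert (Cmod x * Cmod y <= (2 * d) * (2 * d)) by (apply Rmult_le_compat; auto).
      assert (0 <= d) by lra. unfold D in Hd2. nra. }
    apply Rabs_def2 in Hr. destruct Hsg as [-> | ->]; lra.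
Qed.

(* Otherwise the sign of the cross product would separate the fiber, as mirror images lie on
   both sides. *)
Lemma nabla_parallel (k : nat) (l : nat -> R) (x : R) (i j : nat) :
  (i < k)%nat -> (j < k)%nat -> nabla k l x ->
  exists p, inC k l p /\ theta k p = x /\ cross (edge p i) (edge p j) = 0.
Proof.
  intros Hi Hj [[p0 [P1 P2]] Hconn].
  apply NNPP; intros Hno; apply Hconn.
  assert (Hne : forall p, fiber k l x p -> cross (edge p i) (edge p j) <> 0).
  { intros p [Q1 Q2] E; apply Hno; eauto. }
  assert (F0 : fiber k l x p0) by (split; auto).
  pose (pm := fun n => Cconj (p0 n) : R * R).
  assert (Em : forall n, edge pm n = Cconj (edge p0 n)).
  { intros n; unfold edge, pm, Cconj, Cminus, Cplus, Copp; cbn [fst snd]; f_equal; ring. }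
  assert (Fm : fiber k l x pm).
  { split.
    - apply inC_edge; intros n Hn; rewrite Em, Cmod_conj. now apply inC_edge with k.
    - rewrite <- P2, !theta_edge, (csum_ext _ _ (fun n => Cconj (edge p0 n))) by auto.
      now rewrite csum_conj, Cmod_conj. }
  exists (fun p => 0 < 1 * cross (edge p i) (edge p j)),
    (fun p => 0 < -1 * cross (edge p i) (edge p j)).
  splits; try (apply Mopen_cross; auto).
  - intros p Hp; specialize (Hne p Hp); lra.
  - intros p _; lra.
  - pose proof (Hne p0 F0). destruct (Rlt_le_dec 0 (cross (edge p0 i) (edge p0 j))).
    + exists p0; split; auto; lra.
    + exists pm; split; auto. rewrite !Em, cross_conj; lra.
  - pose proof (Hne p0 F0). destruct (Rlt_le_dec 0 (cross (edge p0 i) (edge p0 j))).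
    + exists pm; split; auto. rewrite !Em, cross_conj; lra.
    + exists p0; split; auto; lra.
Qed.

(** [clamp] is 1-Lipschitz and takes its values in the interval. *)
Lemma cont01_clamp (f : R -> R) : cont01 f -> continuity (fun t => f (clamp 0 1 t)).
Proof.
  intros Hf t e He.
  destruct (Hf (clamp 0 1 t) (clamp_bounds 0 1 t Rle_0_1) e He) as (d & Hd & H).
  exists d; split; auto. intros s [_ Hs]. apply H; [apply clamp_bounds; lra|].
  eapply Rle_lt_trans; [|exact Hs]. simpl; unfold Rdist.
  unfold clamp, Rmax, Rmin; destruct (Rle_dec 1 s), (Rle_dec 1 t);
    repeat match goal with |- context [Rle_dec 0 ?x] => destruct (Rle_dec 0 x) end;
    unfold Rabs; repeat match goal with |- context [Rcase_abs ?x] => destruct (Rcase_abs x) end;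
    lra.
Qed.

(** Saturated open sets are open for [cdist], so a continuous choice of representatives is
    continuous into the quotient. *)
Lemma Mpath_cont_placement (k : nat) (l : nat -> R) (F : nat -> R -> C) :
  (forall i, (i < k)%nat -> ccont (F i)) ->
  (forall t, 0 <= t <= 1 -> inC k l (placement (fun i => F i t))) ->
  Mpath_cont k l (fun t => placement (fun i => F i t)).
Proof.
  intros HF Hin U [_ HU] t Ht Ut.
  destruct (HU _ (Hin t Ht) Ut) as (eps & Heps & H).
  set (p := placement (fun i => F i t)) in *.
  assert (Hc : continuity_pt (fun s => cdist k p (placement (fun i => F i s))) t).
  { unfold cdist.
    apply (continuity_pt_finite_SF (fun i s => edist (p i) (placement (fun i => F i s) i))).
    intros n Hn.
    assert (Hp : ccont (fun s => placement (fun i => F i s) n)).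
    { unfold placement; apply ccont_csum. intros i Hi; apply in_seq in Hi; apply HF; lia. }
    destruct Hp as [Hp1 Hp2].
    assert (G : continuity (fun s => sqrt ((fst (p n) - fst (placement (fun i => F i s) n)) ^ 2
      + (snd (p n) - snd (placement (fun i => F i s) n)) ^ 2))) by auto 8 with cont.
    exact (G t). }
  destruct (Hc eps Heps) as (d & Hd & Q).
  exists d; split; auto. intros s Hs Hst.
  (* The limit inside [continuity_pt] excludes the base point. *)
  destruct (Req_dec s t) as [->|Hne]; [auto|].
  apply H; [apply Hin; auto|].
  specialize (Q s). simpl in Q; unfold Rdist in Q.
  assert (Z : cdist k p p = 0).
  { unfold cdist. rewrite (sum_eq _ (fun _ => 0)), sum_cte; [ring|].
    intros i _; unfold edist. replace (_ + _) with 0 by ring. apply sqrt_0. }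
  fold p in Q. rewrite Z, Rminus_0_r in Q.
  eapply Rle_lt_trans; [apply Rle_abs|]. apply Q; split; auto.
  split; [exact I|auto].
Qed.

(** The distinguished edges come last, so that inductions on [rest] add the others in front. *)
Lemma two_longest (k : nat) (l : nat -> R) : (2 <= k)%nat ->
  exists a b rest, Permutation (List.seq 0 k) (rest ++ b :: a :: nil) /\
    l b <= l a /\ forall i, In i rest -> l i <= l b.
Proof.
  intros Hk.
  destruct (extract_max l (List.seq 0 k)) as (a & M & HP & HM).
  { destruct k; [lia|discriminate]. }
  destruct (extract_max l M) as (b & rest & HP' & HM').
  { intros ->. apply Permutation_length in HP. rewrite length_seq in HP; simpl in HP; lia. }
  exists a, b, rest; splits.
  - rewrite HP, HP'. rewrite Permutation_app_comm. simpl. apply perm_swap.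
  - apply HM. apply Permutation_in with (b :: rest); simpl; auto using Permutation_sym.
  - auto.
Qed.

Theorem mainTheorem8 (k : nat) (l : nat -> R) (p q : config) (alpha : R -> R) :
  (2 <= k)%nat ->
  (forall i : nat, (i < k)%nat -> 0 < l i) ->
  inC k l p -> inC k l q ->
  cont01 alpha ->
  (forall x, 0 <= x <= 1 -> range_P k l (alpha x)) ->
  (exists eps delta, eps > 0 /\ delta > 0 /\
     (forall x, 0 <= x <= eps -> alpha x = theta k p) /\
     (forall x, 1 - delta <= x <= 1 -> alpha x = theta k q)) ->
  (exists x, 0 <= x <= 1 /\ nabla k l (alpha x)) ->
  exists f : R -> config,
    (forall t, 0 <= t <= 1 -> inC k l (f t)) /\
    Mpath_cont k l f /\
    congruent k p (f 0) /\ congruent k q (f 1) /\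
    (forall t, 0 <= t <= 1 -> theta k (f t) = alpha t).
Proof.
  intros Hk Hl Hp Hq Hal Hrg (eps & del & He & Hd & Hep & Hdq) (x & Hx & Hnab).
  destruct (two_longest k l Hk) as (a & b & rest & HP & Hab & Hrest).
  set (L := rest ++ b :: a :: nil) in *.
  assert (HL : forall i, In i L <-> (i < k)%nat).
  { intros i; split; intros Hi.
    - apply Permutation_in with (l' := List.seq 0 k) in Hi; [|now apply Permutation_sym].
      apply in_seq in Hi; lia.
    - apply Permutation_in with (1 := HP), in_seq; lia. }
  assert (Hnd : NoDup L) by (apply (Permutation_NoDup HP), seq_NoDup).
  assert (Ha : (a < k)%nat) by (apply HL, in_or_app; simpl; auto).
  assert (Hb : (b < k)%nat) by (apply HL, in_or_app; simpl; auto).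
  assert (Hab' : 0 < l b <= l a) by auto.
  assert (Hrest' : forall i, In i rest -> 0 < l i <= l b).
  { intros i Hi; split; auto. apply Hl, HL, in_or_app; auto. }
  assert (Hth : forall r, theta k r = Cmod (csum L (edge r))).
  { intros r; now rewrite theta_edge, (csum_perm _ _ _ HP). }
  assert (HE : forall r, inC k l r -> forall i, In i L -> Cmod (edge r i) = l i).
  { intros r Hr i Hi; apply (proj1 (inC_edge k l r)); auto; now apply HL. }
  (* The bound [/ 3] keeps the two end intervals disjoint. *)
  set (e0 := Rmin eps (/ 3)). set (d0 := Rmin del (/ 3)).
  assert (He0 : 0 < e0 <= eps /\ e0 <= / 3).
  { unfold e0; repeat split; [apply Rmin_glb_lt; lra|apply Rmin_l|apply Rmin_r]. }
  assert (Hd0 : 0 < d0 <= del /\ d0 <= / 3).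
  { unfold d0; repeat split; [apply Rmin_glb_lt; lra|apply Rmin_l|apply Rmin_r]. }
  (* The change of section has to happen between the end moves. An [x] inside an end interval is
     moved to the boundary of that interval, where [alpha] has the same value. *)
  set (ts := clamp e0 (1 - d0) x).
  assert (Hts : e0 <= ts <= 1 - d0) by (apply clamp_bounds; lra).
  assert (Ets : alpha ts = alpha x).
  { unfold ts. destruct (Rle_lt_dec x e0) as [H1|H1]; [|destruct (Rle_lt_dec (1 - d0) x)].
    - rewrite clamp_low, !Hep; lra.
    - rewrite clamp_high, !Hdq; lra.
    - rewrite clamp_id; lra. }
  destruct (nabla_parallel k l (alpha x) a b Ha Hb Hnab) as (w & W1 & W2 & W3).
  pose (al := fun t => alpha (clamp 0 1 t)).
  assert (Eal : forall t, 0 <= t <= 1 -> al t = alpha t).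
  { intros t Ht; unfold al; now rewrite clamp_id. }
  destruct (lift_edges l rest a b (edge p) (edge q) al e0 d0 ts)
    as (F & e & f & E1 & E2 & E3 & E4); auto; try lra.
  - apply cont01_clamp; auto.
  - intros t. destruct (Hrg (clamp 0 1 t) (clamp_bounds 0 1 t Rle_0_1)) as (r & R1 & R2).
    unfold al. rewrite <- R2, Hth. apply reach, HE; auto.
  - intros t Ht; fold L. rewrite Eal, Hep, Hth; lra.
  - intros t Ht; fold L. rewrite Eal, Hdq, Hth; lra.
  - rewrite Eal, Ets, <- W2, Hth by lra. apply crossing_exists; auto.
  - fold L in E3, E4.
    assert (Hin : forall t, 0 <= t <= 1 -> inC k l (placement (fun i => F i t))).
    { intros t Ht. apply inC_edge; intros i Hi. rewrite edge_placement.
      apply E4; auto; now apply HL. }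
    exists (fun t => placement (fun i => F i t)); splits; auto.
    + apply Mpath_cont_placement; auto. intros i Hi; apply E3, HL, Hi.
    + apply congruent_of_edges with e; auto.
      intros i Hi; rewrite edge_placement; apply E3, HL, Hi.
    + apply congruent_of_edges with f; auto.
      intros i Hi; rewrite edge_placement; apply E3, HL, Hi.
    + intros t Ht. rewrite Hth, (csum_ext _ _ (fun i => F i t)).
      * rewrite <- Eal by auto. now apply E4.
      * intros i _; apply edge_placement.
Qed.
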